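(* Let $\gamma:[t_0,t_1]\to\mathcal V_{n+1}$ be an ordinary admissible evolution, with lift $\hat\gamma:t\mapsto(q^i(t),z^A(t))$ to $\mathcal A$, which is an extremal of the action functional $\mathcal I[\gamma]=\int_{t_0}^{t_1}\mathscr L(t,q(t),z(t))\,dt$ among admissible evolutions with the same end-points. Then there exist functions $p_i(t)$ on $[t_0,t_1]$ such that the curve $\tilde\gamma:t\mapsto(q^i(t),z^A(t),p_i(t))$ in $\mathscr C(\mathcal A)$ is an extremal of the functional $\mathcal I[\tilde\gamma]=\int_{t_0}^{t_1}\big(p_i\,\tfrac{dq^i}{dt}-\mathscr H\big)dt$, $\mathscr H=p_i\psi^i-\mathscr L$, with respect to arbitrary deformations keeping $q^i(t_0),q^i(t_1)$ fixed; equivalently, along $\tilde\gamma$ $$\frac{dp_i}{dt}+p_k\frac{\partial\psi^k}{\partial q^i}=\frac{\partial\mathscr L}{\partial q^i},\qquad p_k\frac{\partial\psi^k}{\partial z^A}=\frac{\partial\mathscr L}{\partial z^A}.$$ In particular $\gamma$ is the projection of at least one such extremal $\tilde\gamma$.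
   Context: $\mathcal V_{n+1}\to\mathbb R$ is a fibre bundle with local fibred coordinates $t,q^1,\dots,q^n$; $\mathcal A\subset j_1(\mathcal V_{n+1})$ is a submanifold fibred over $\mathcal V_{n+1}$ with coordinates $t,q^i,z^A$ ($A=1,\dots,r$), embedded via $\dot q^i=\psi^i(t,q,z)$ with $\operatorname{rank}\|\partial\psi^i/\partial z^A\|=r$; $\mathscr L\in C^\infty(\mathcal A)$. $\mathscr C(\mathcal A)$ is the affine bundle over $\mathcal A$ with local coordinates $t,q^i,z^A,p_i$ (the $p_i$ being fibre coordinates modelled on the pull-back of $V^*(\mathcal V_{n+1})$). An evolution $\gamma:t\mapsto q^i(t)$ is admissible iff it has a lift $\hat\gamma:t\mapsto(q^i(t),z^A(t))$ with $dq^i/dt=\psi^i(t,q,z)$; an admissible deformation is a smooth one-parameter family of admissible evolutions $\gamma_\xi$, $\gamma_0=\gamma$. An admissible infinitesimal deformation of $\hat\gamma$ is a field $X^i\partial/\partial q^i+\Gamma^A\partial/\partial z^A$ along $\hat\gamma$ satisfying $\dot X^i=(\partial\psi^i/\partial q^k)X^k+(\partial\psi^i/\partial z^A)\Gamma^A$. The admissible evolution $\gamma$ is called ordinary iff every admissible infinitesimal deformation with $X^i(t_0)=X^i(t_1)=0$ is tangent (at $\xi=0$) to an admissible deformation $\gamma_\xi$ with fixed end-points. Extremal of $\mathcal I[\gamma]$ means $\frac{d}{d\xi}\mathcal I[\gamma_\xi]|_{\xi=0}=0$ for every admissible deformation with fixed end-points. All curves are differentiable and lie in one coordinate chart. *)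

(* Defs.v *)
From Stdlib Require Import Reals ClassicalEpsilon.
From mathcomp Require Import all_boot.
Set Implicit Arguments. Unset Strict Implicit. Unset Printing Implicit Defensive.
Local Open Scope R_scope.

Definition upd (I : eqType) (x : I -> R) (i : I) (h : R) : I -> R :=
  fun j => if j == i then h else x j.

Definition is_partial (I : eqType) (F : (I -> R) -> R) (i : I) (x : I -> R) (l : R) : Prop :=
  derivable_pt_lim (fun h => F (upd x i h)) (x i) l.

(* the partial derivative (meaningful when it exists; it is then unique) *)
Definition pd (I : eqType) (F : (I -> R) -> R) (i : I) (x : I -> R) : R :=
  epsilon (inhabits 0) (fun l => is_partial F i x l).

Definition open_set (I : finType) (U : (I -> R) -> Prop) : Prop :=
  forall x, U x -> exists d, 0 < d /\
    forall y : I -> R, (forall i, Rabs (y i - x i) < d) -> U y.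

Definition cont_on (I : finType) (U : (I -> R) -> Prop) (F : (I -> R) -> R) : Prop :=
  forall x, U x -> forall eps, 0 < eps -> exists d, 0 < d /\
    forall y, U y -> (forall i, Rabs (y i - x i) < d) -> Rabs (F y - F x) < eps.

Fixpoint Ck (I : finType) (U : (I -> R) -> Prop) (k : nat) (F : (I -> R) -> R) : Prop :=
  match k with
  | O => cont_on U F
  | S k' => cont_on U F /\
      exists DF : I -> (I -> R) -> R,
        (forall i x, U x -> is_partial F i x (DF i x)) /\ (forall i, Ck U k' (DF i))
  end.

Definition smooth_on (I : finType) (U : (I -> R) -> Prop) (F : (I -> R) -> R) : Prop :=
  forall k, Ck U k F.

Definition sumR (I : finType) (f : I -> R) : R := foldr Rplus 0 (map f (enum I)).

Notation coord n r := (unit + ('I_n + 'I_r))%type.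

Definition pt (n r : nat) (t : R) (q : 'I_n -> R) (z : 'I_r -> R) : coord n r -> R :=
  fun c => match c with
           | inl _ => t
           | inr (inl i) => q i
           | inr (inr a) => z a
           end.

Definition dt (n r : nat) : coord n r := inl tt.
Definition dq (n r : nat) (i : 'I_n) : coord n r := inr (inl i).
Definition dz (n r : nat) (a : 'I_r) : coord n r := inr (inr a).

(* Standing assumptions: U is the (open) chart domain of A, the embedding
   (t,q,z) |-> (t,q,psi(t,q,z)) is smooth, injective, of rank r in z, and a
   homeomorphism onto its image; L is smooth. *)
Definition setup (n r : nat) (U : (coord n r -> R) -> Prop)
  (psi : 'I_n -> (coord n r -> R) -> R) (L : (coord n r -> R) -> R) : Prop :=
  open_set U /\
  (forall i, smooth_on U (psi i)) /\
  smooth_on U L /\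
  (forall x, U x -> forall c : 'I_r -> R,
      (forall i, sumR (fun a => pd (psi i) (dz n a) x * c a) = 0) -> forall a, c a = 0) /\
  (forall x y, U x -> U y -> x (dt n r) = y (dt n r) ->
      (forall i, x (dq r i) = y (dq r i)) -> (forall i, psi i x = psi i y) ->
      forall a, x (dz n a) = y (dz n a)) /\
  (forall x, U x -> forall eps, 0 < eps -> exists d, 0 < d /\
      forall y, U y -> Rabs (y (dt n r) - x (dt n r)) < d ->
      (forall i, Rabs (y (dq r i) - x (dq r i)) < d) ->
      (forall i, Rabs (psi i y - psi i x) < d) ->
      forall c, Rabs (y c - x c) < eps).

Definition admissible_lift (n r : nat) (U : (coord n r -> R) -> Prop)
  (psi : 'I_n -> (coord n r -> R) -> R) (t0 t1 : R)
  (q : R -> 'I_n -> R) (z : R -> 'I_r -> R) : Prop :=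
  forall t, t0 <= t <= t1 ->
    U (pt t (q t) (z t)) /\
    (forall i, derivable_pt_lim (fun s => q s i) t (psi i (pt t (q t) (z t)))) /\
    (forall a, exists l, derivable_pt_lim (fun s => z s a) t l).

(* An admissible deformation (Q xi, Z xi), |xi| < eps, of the lift (q,z) with
   fixed end-points: smooth in (xi,t) (on an open neighbourhood of
   (-eps,eps) x [t0,t1]; coordinate true = xi, false = t), each member an
   admissible lift, member 0 equal to (q,z). *)
Definition adm_deformation (n r : nat) (U : (coord n r -> R) -> Prop)
  (psi : 'I_n -> (coord n r -> R) -> R) (t0 t1 : R)
  (q : R -> 'I_n -> R) (z : R -> 'I_r -> R)
  (eps : R) (Q : R -> R -> 'I_n -> R) (Z : R -> R -> 'I_r -> R) : Prop :=
  0 < eps /\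
  (exists a b, a < t0 /\ t1 < b /\
     let D := fun x : bool -> R => - eps < x true < eps /\ a < x false < b in
     (forall i, smooth_on D (fun x => Q (x true) (x false) i)) /\
     (forall c, smooth_on D (fun x => Z (x true) (x false) c))) /\
  (forall xi, - eps < xi < eps -> admissible_lift U psi t0 t1 (Q xi) (Z xi)) /\
  (forall t, t0 <= t <= t1 -> Q 0 t = q t /\ Z 0 t = z t) /\
  (forall xi, - eps < xi < eps -> Q xi t0 = q t0 /\ Q xi t1 = q t1).

Definition action_value (n r : nat) (L : (coord n r -> R) -> R) (t0 t1 : R)
  (q : R -> 'I_n -> R) (z : R -> 'I_r -> R) (v : R) : Prop :=
  exists pr : Riemann_integrable (fun t => L (pt t (q t) (z t))) t0 t1,
    RiemannInt pr = v.

Definition extremal (n r : nat) (U : (coord n r -> R) -> Prop)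
  (psi : 'I_n -> (coord n r -> R) -> R) (L : (coord n r -> R) -> R) (t0 t1 : R)
  (q : R -> 'I_n -> R) (z : R -> 'I_r -> R) : Prop :=
  forall eps Q Z, adm_deformation U psi t0 t1 q z eps Q Z ->
    exists J : R -> R,
      (forall xi, - eps < xi < eps -> action_value L t0 t1 (Q xi) (Z xi) (J xi)) /\
      derivable_pt_lim J 0 0.

Definition adm_inf_deformation (n r : nat)
  (psi : 'I_n -> (coord n r -> R) -> R) (t0 t1 : R)
  (q : R -> 'I_n -> R) (z : R -> 'I_r -> R)
  (X : R -> 'I_n -> R) (G : R -> 'I_r -> R) : Prop :=
  (exists a b, a < t0 /\ t1 < b /\
     let D := fun x : unit -> R => a < x tt < b in
     (forall i, smooth_on D (fun x => X (x tt) i)) /\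
     (forall c, smooth_on D (fun x => G (x tt) c))) /\
  (forall t, t0 <= t <= t1 -> forall i,
     derivable_pt_lim (fun s => X s i) t
       (sumR (fun k => pd (psi i) (dq r k) (pt t (q t) (z t)) * X t k) +
        sumR (fun a => pd (psi i) (dz n a) (pt t (q t) (z t)) * G t a))).

Definition ordinary (n r : nat) (U : (coord n r -> R) -> Prop)
  (psi : 'I_n -> (coord n r -> R) -> R) (t0 t1 : R)
  (q : R -> 'I_n -> R) (z : R -> 'I_r -> R) : Prop :=
  forall X G, adm_inf_deformation psi t0 t1 q z X G ->
    (forall i, X t0 i = 0) -> (forall i, X t1 i = 0) ->
    exists eps Q Z, adm_deformation U psi t0 t1 q z eps Q Z /\
      forall t, t0 <= t <= t1 ->
        (forall i, derivable_pt_lim (fun xi => Q xi t i) 0 (X t i)) /\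
        (forall a, derivable_pt_lim (fun xi => Z xi t a) 0 (G t a)).

(* Main.v *)
From HB Require Import structures.
From Stdlib Require Import Reals Ranalysis5 PSeries_reg Factorial Lra.
From Stdlib Require Import ClassicalEpsilon FunctionalExtensionality.
From mathcomp Require Import all_boot.
From Coquelicot Require Import Coquelicot.
Require Import Defs.
Set Implicit Arguments. Unset Strict Implicit. Unset Printing Implicit Defensive.
Local Open Scope R_scope.

(** The infinitesimal deformations of the lift are the solutions of a linear
    control system X' = A X + B G, and by ordinarity and extremality the first
    variation, the integral of l.X + m.G, vanishes on all of them that have
    X(t0) = X(t1) = 0. Costates p, i.e. solutions of p' = l - A^T p, form an affine
    space, and d/dt (p.X) = l.X + (B^T p).G. Choose p so that the residual
    G = m - B^T p is L2-orthogonal to B^T p' for every solution p' of the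
    homogeneous adjoint equation. Pairing with the p' that are basis vectors at t1
    shows that G, used as a control, steers 0 to 0; the first variation then equals
    the integral of |G|^2, so that m = B^T p. Since l.X + m.G has to be integrated
    along smooth fields, q and z are first extended smoothly beyond [t0, t1]. *)

(** * Finite sums and smooth functions *)

(** The residual serves as a control only if it is smooth on an open interval around [t0, t1], as
    infinitesimal deformations are required to be, whereas the lift is assumed merely differentiable
    at the points of [t0, t1]. Smoothness of the coefficients therefore has to come from ordinarity
    itself. It then passes to all solutions of the linear equations, so costates, residual and
    steered field are smooth in turn. Each equation is solved on a slightly smaller interval, on
    which its coefficients are bounded; this is the origin of the nested intervals. The second
    obstacle is abnormality: the functions B^T p' attached to independent p' may be linearly
    dependent on [t0, t1], in which case some end-point displacements are out of reach and p is not
    unique. Their Gram matrix can then be singular, so the orthogonal residual is not found by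
    inverting it but by a Gram-Schmidt recursion that tolerates vectors of length zero. What has to
    survive the recursion is that the result is still the residual of some costate. *)

HB.instance Definition _ := Monoid.isComLaw.Build R 0 Rplus
  (fun x y z => esym (Rplus_assoc x y z)) Rplus_comm Rplus_0_l.
HB.instance Definition _ := Monoid.isMulLaw.Build R 0 Rmult Rmult_0_l Rmult_0_r.
HB.instance Definition _ := Monoid.isAddLaw.Build R Rmult Rplus
  (fun x y z => Rmult_plus_distr_r x y z) Rmult_plus_distr_l.

Lemma sumRE (I : finType) (f : I -> R) : sumR f = \big[Rplus/0]_i f i.
Proof. by rewrite /sumR -big_enum unlock; elim: (enum I) => //= i s ->. Qed.

Section Sums.
Variables I J : finType.
Implicit Types f g : I -> R.

Lemma sumR_ext f g : (forall i, f i = g i) -> sumR f = sumR g.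
Proof. by move=> fg; rewrite !sumRE; apply: eq_bigr => i _. Qed.

Lemma sumR_plus f g : sumR (fun i => f i + g i) = sumR f + sumR g.
Proof. by rewrite !sumRE big_split. Qed.

Lemma sumR_scal k f : sumR (fun i => k * f i) = k * sumR f.
Proof. by rewrite !sumRE big_distrr. Qed.

Lemma sumR_exchange (F : I -> J -> R) :
  sumR (fun i => sumR (F i)) = sumR (fun j => sumR (F^~ j)).
Proof.
transitivity (\big[Rplus/0]_i \big[Rplus/0]_j F i j).
  by rewrite sumRE; apply: eq_bigr => i _; rewrite sumRE.
by rewrite exchange_big sumRE; apply: eq_bigr => i _; rewrite sumRE.
Qed.

Lemma sumR_delta f i : sumR (fun j => (if j == i then 1 else 0) * f j) = f i.
Proof.
rewrite sumRE (bigD1 i) //= eqxx big1; first by rewrite Rplus_0_r Rmult_1_l.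
by move=> j /negbTE ->; rewrite Rmult_0_l.
Qed.

Lemma sumR_le f g : (forall i, f i <= g i) -> sumR f <= sumR g.
Proof.
move=> fg; rewrite !sumRE; apply: (big_ind2 (fun x y => x <= y)) => //.
- exact: Rle_refl.
- by move=> *; apply: Rplus_le_compat.
Qed.

Lemma sumR_ge0 f : (forall i, 0 <= f i) -> 0 <= sumR f.
Proof.
move=> f0; rewrite sumRE; apply: (big_ind (fun x => 0 <= x)) => //.
- exact: Rle_refl.
- by move=> *; apply: Rplus_le_le_0_compat.
Qed.

Lemma Rabs_sumR f : Rabs (sumR f) <= sumR (fun i => Rabs (f i)).
Proof.
rewrite !sumRE; apply: (big_ind2 (fun x y => Rabs x <= y)) => //.
- by rewrite Rabs_R0; apply: Rle_refl.
- move=> x1 x2 y1 y2 ? ?; apply: Rle_trans (Rabs_triang _ _) _.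
  exact: Rplus_le_compat.
- by move=> *; apply: Rle_refl.
Qed.

Lemma le_sumR f i : (forall j, 0 <= f j) -> f i <= sumR f.
Proof.
move=> f0; rewrite -{1}(sumR_delta f i); apply: sumR_le => j.
by have := f0 j; case: (j == i); lra.
Qed.

End Sums.

Lemma sumR0 (I : finType) (f : I -> R) : (forall i, f i = 0) -> sumR f = 0.
Proof. by move=> f0; rewrite sumRE big1. Qed.

Lemma sumR_coord n r (f : coord n r -> R) :
  sumR f = f (dt n r) + (sumR (fun i => f (dq r i)) + sumR (fun a => f (dz n a))).
Proof.
rewrite !sumRE (big_sumType Rplus) /= (big_sumType Rplus) /=; congr (_ + _).
by rewrite -[RHS](sumR_delta (fun _ : unit => f (dt n r)) tt) sumRE;
  apply: eq_bigr => -[] _; rewrite eqxx Rmult_1_l.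
Qed.

(** The minimum of finitely many radii works for all indices because each condition persists when
    the radius shrinks. This turns coordinatewise epsilon-delta statements into uniform ones. *)
Lemma common_radius (J : finType) (P : J -> R -> Prop) :
  (forall j d e, P j d -> 0 < e <= d -> P j e) ->
  (forall j, exists d, 0 < d /\ P j d) -> exists d, 0 < d /\ forall j, P j d.
Proof.
move=> Pmono Pex.
have [d [d0 dP]] : exists d, 0 < d /\ forall j, j \in enum J -> P j d.
  elim: (enum J) => [|j s [d [d0 dP]]]; first by exists 1; split => //; lra.
  have [e [e0 eP]] := Pex j.
  exists (Rmin d e); have m0 : 0 < Rmin d e by apply: Rmin_glb_lt.
  split=> // i; rewrite inE => /orP[/eqP->|/dP Pi].
  - apply: (Pmono _ _ _ eP); split=> //; exact: Rmin_r.
  - apply: (Pmono _ _ _ Pi); split=> //; exact: Rmin_l.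
by exists d; split=> // j; apply: dP; rewrite mem_enum.
Qed.

(** * Partial derivatives and the classes C^k *)

Section Calculus.
Variable I : finType.
Implicit Types (U : (I -> R) -> Prop) (F G : (I -> R) -> R) (x y : I -> R).

Lemma upd_id x i : upd x i (x i) = x.
Proof.
by apply: functional_extensionality => j; rewrite /upd; case: eqP => // ->.
Qed.

Lemma upd_dist x i h j : Rabs (upd x i h j - x j) <= Rabs (h - x i).
Proof.
rewrite /upd; case: eqP => [->|_]; first exact: Rle_refl.
by rewrite Rminus_diag Rabs_R0; apply: Rabs_pos.
Qed.

Lemma derivable_pt_lim_eq_near (f g : R -> R) (x l d : R) : 0 < d ->
  (forall y : R, Rabs (y - x) < d -> f y = g y) ->
  derivable_pt_lim f x l -> derivable_pt_lim g x l.
Proof.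
move=> d0 fg; rewrite -!is_derive_Reals => df.
apply: (is_derive_ext_loc f) => //; exists (mkposreal _ d0) => y xy; exact: fg.
Qed.

Lemma is_partial_eq U F G i x l : open_set U -> U x ->
  (forall y, U y -> F y = G y) -> is_partial F i x l -> is_partial G i x l.
Proof.
move=> oU Ux FG; have [d [d0 dU]] := oU x Ux.
apply: derivable_pt_lim_eq_near d0 _ => h hx; apply: FG; apply: dU => j.
exact: Rle_lt_trans (upd_dist _ _ _ _) hx.
Qed.

(** On an open set, partial derivatives depend only on the values inside it. The lemma serves to
    replace derivative witnesses by [pd], with which they agree only on [U]. *)
Lemma Ck_eq U k F G : open_set U -> (forall y, U y -> F y = G y) ->
  Ck U k F -> Ck U k G.
Proof.
move=> oU FG.
have contG : cont_on U F -> cont_on U G.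
  move=> cF x Ux e e0; have [d [d0 dF]] := cF x Ux e e0.
  by exists d; split=> // y Uy; rewrite -!FG //; apply: dF.
case: k => [|k] /=; first exact: contG.
move=> [cF [DF [pF cDF]]]; split; first exact: contG cF.
exists DF; split=> [i x Ux|//]; exact: is_partial_eq oU Ux FG (pF i x Ux).
Qed.

Lemma pd_unique F i x l : is_partial F i x l -> pd F i x = l.
Proof.
move=> pF; apply: (uniqueness_limite _ _ _ _ _ pF).
by apply: epsilon_spec; exists l.
Qed.

Lemma smooth_partial U F i x : smooth_on U F -> U x -> is_partial F i x (pd F i x).
Proof.
move=> sF Ux; have [_ [DF [pF _]]] := sF 1%N.
by rewrite (pd_unique (pF i x Ux)); apply: pF.
Qed.

(** Each order k comes with its own witnesses [DF]; uniqueness of derivatives identifies all of them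
    on [U] with the single function [pd F i]. *)
Lemma smooth_pd U F i : open_set U -> smooth_on U F -> smooth_on U (pd F i).
Proof.
move=> oU sF k; have [_ [DF [pF cDF]]] := sF k.+1.
apply: Ck_eq oU _ (cDF i) => y Uy; apply: esym; apply: pd_unique; exact: pF.
Qed.

Lemma Ck_cont U k F : Ck U k F -> cont_on U F.
Proof. by case: k => [|k] // []. Qed.

Lemma Ck_pred U k F : Ck U k.+1 F -> Ck U k F.
Proof.
elim: k F => [|k IH] F; first by case.
by move=> [cF [DF [pF cDF]]]; split=> //; exists DF; split=> [//|i]; apply: IH (cDF i).
Qed.

Lemma Ck_sub U V k F : (forall x, V x -> U x) -> Ck U k F -> Ck V k F.
Proof.
move=> VU.
have sub0 : forall H, cont_on U H -> cont_on V H.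
  move=> H cH x Vx e e0; have [d [d0 dH]] := cH x (VU x Vx) e e0.
  by exists d; split=> // y Vy; apply/dH/VU.
elim: k F => [|k IH] F; first exact: sub0.
move=> [cF [DF [pF cDF]]]; split; first exact: sub0.
exists DF; split=> [i x Vx|i].
  by apply: pF; apply: VU.
exact: IH (cDF i).
Qed.

Lemma Ck_const U k c : Ck U k (fun=> c).
Proof.
have cont_const a : cont_on U (fun=> a).
  move=> x _ e e0; exists 1; split; first lra.
  by move=> *; rewrite Rminus_diag Rabs_R0.
elim: k c => [|k IH] c //=; split=> //.
exists (fun _ _ => 0); split=> [i x _|//]; exact: derivable_pt_lim_const.
Qed.

Lemma Ck_coord U k i : Ck U k (fun x => x i).
Proof.
have c0 : cont_on U (fun x => x i).
  by move=> x _ e e0; exists e; split=> // y _; apply.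
case: k => [//|k] /=; split=> //.
exists (fun j _ => if i == j then 1 else 0); split=> [j x _|j].
  rewrite /is_partial /upd; case: eqP => _; first exact: derivable_pt_lim_id.
  exact: derivable_pt_lim_const.
exact: Ck_const.
Qed.

Lemma cont_on_plus U F G : cont_on U F -> cont_on U G ->
  cont_on U (fun x => F x + G x).
Proof.
move=> cF cG x Ux e e0.
have e2 : 0 < e / 2 by lra.
have [d1 [d10 dF]] := cF x Ux _ e2; have [d2 [d20 dG]] := cG x Ux _ e2.
exists (Rmin d1 d2); split; first exact: Rmin_glb_lt.
move=> y Uy yx.
have := dF y Uy (fun i => Rlt_le_trans _ _ _ (yx i) (Rmin_l _ _)).
have := dG y Uy (fun i => Rlt_le_trans _ _ _ (yx i) (Rmin_r _ _)).
by split_Rabs; lra.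
Qed.

Lemma cont_on_mult U F G : cont_on U F -> cont_on U G ->
  cont_on U (fun x => F x * G x).
Proof.
move=> cF cG x Ux e e0.
set B := Rabs (F x) + Rabs (G x) + 1.
have B0 : 0 < B by rewrite /B; have := Rabs_pos (F x); have := Rabs_pos (G x); lra.
(* The bound [e1 <= 1] absorbs the product of the two increments into the summand 1 of [B]. *)
have [e1 [e10 e11 eB]] : exists e1, [/\ 0 < e1, e1 <= 1 & B * e1 <= e / 2].
  exists (Rmin 1 (e / (2 * B))); split.
  - apply: Rmin_glb_lt; first lra; apply: Rdiv_lt_0_compat; lra.
  - exact: Rmin_l.
  - have -> : e / 2 = B * (e / (2 * B)) by field; lra.
    apply: Rmult_le_compat_l (Rmin_r _ _); lra.
have [d1 [d10 dF]] := cF x Ux _ e10; have [d2 [d20 dG]] := cG x Ux _ e10.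
exists (Rmin d1 d2); split; first exact: Rmin_glb_lt.
move=> y Uy yx.
have h1 := dF y Uy (fun i => Rlt_le_trans _ _ _ (yx i) (Rmin_l _ _)).
have h2 := dG y Uy (fun i => Rlt_le_trans _ _ _ (yx i) (Rmin_r _ _)).
have -> : F y * G y - F x * G x = (F y - F x) * (G y - G x) +
  (F x * (G y - G x) + G x * (F y - F x)) by ring.
apply: Rle_lt_trans (Rabs_triang _ _) _.
have := Rabs_triang (F x * (G y - G x)) (G x * (F y - F x)).
rewrite !Rabs_mult => h3.
have p1 := Rabs_pos (F x); have p2 := Rabs_pos (G x).
have p3 := Rabs_pos (F y - F x); have p4 := Rabs_pos (G y - G x).
have m1 : Rabs (F x) * Rabs (G y - G x) <= Rabs (F x) * e1
  by apply: Rmult_le_compat_l; lra.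
have m2 : Rabs (G x) * Rabs (F y - F x) <= Rabs (G x) * e1
  by apply: Rmult_le_compat_l; lra.
have m3 : Rabs (F y - F x) * Rabs (G y - G x) <= 1 * e1
  by apply: Rmult_le_compat; lra.
rewrite /B in eB; lra.
Qed.

Lemma Ck_plus U k F G : Ck U k F -> Ck U k G -> Ck U k (fun x => F x + G x).
Proof.
elim: k F G => [|k IH] F G; first exact: cont_on_plus.
move=> [cF [DF [pF cDF]]] [cG [DG [pG cDG]]].
split; first exact: cont_on_plus.
exists (fun i x => DF i x + DG i x); split=> [i x Ux|i].
  exact: derivable_pt_lim_plus (pF i x Ux) (pG i x Ux).
exact: IH (cDF i) (cDG i).
Qed.

Lemma Ck_mult U k F G : Ck U k F -> Ck U k G -> Ck U k (fun x => F x * G x).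
Proof.
elim: k F G => [|k IH] F G; first exact: cont_on_mult.
move=> CF CG; have CF' := Ck_pred CF; have CG' := Ck_pred CG.
move: CF CG => [cF [DF [pF cDF]]] [cG [DG [pG cDG]]].
split; first exact: cont_on_mult.
exists (fun i x => DF i x * G x + F x * DG i x); split=> [i x Ux|i].
  have := derivable_pt_lim_mult _ _ _ _ _ (pF i x Ux) (pG i x Ux).
  by rewrite upd_id.
exact: Ck_plus (IH _ _ (cDF i) CG') (IH _ _ CF' (cDG i)).
Qed.

Lemma Ck_sum (J : finType) U k (F : J -> (I -> R) -> R) :
  (forall j, Ck U k (F j)) -> Ck U k (fun x => sumR (F^~ x)).
Proof.
move=> cF; rewrite /sumR; elim: (enum J) => [|j s IH] /=; first exact: Ck_const.
exact: Ck_plus (cF j) IH.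
Qed.

End Calculus.

Lemma derivable_pt_lim_sumR (J : finType) (f : J -> R -> R) x (l : J -> R) :
  (forall j, derivable_pt_lim (f j) x (l j)) ->
  derivable_pt_lim (fun t => sumR (f^~ t)) x (sumR l).
Proof.
move=> df; rewrite /sumR; elim: (enum J) => [|j s IH] /=.
  exact: derivable_pt_lim_const.
exact: derivable_pt_lim_plus (df j) IH.
Qed.

(** * Chain rule *)

Section ChainRule.
Variables (I : finType) (U : (I -> R) -> Prop) (F : (I -> R) -> R).
Variable DF : I -> (I -> R) -> R.
Hypothesis oU : open_set U.
Hypothesis pF : forall i x, U x -> is_partial F i x (DF i x).
Hypothesis cDF : forall i, cont_on U (DF i).

(* Passing from x to y one coordinate at a time, with the mean value theorem
   at each step. *)
Lemma total_increment x e : U x -> 0 < e -> exists d, 0 < d /\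
  forall y, (forall i, Rabs (y i - x i) < d) ->
  Rabs (F y - F x - sumR (fun i => DF i x * (y i - x i)))
    <= e * sumR (fun i => Rabs (y i - x i)).
Proof.
move=> Ux e0.
have [d [d0 dP]] : exists d, 0 < d /\ forall i y,
    (forall j, Rabs (y j - x j) < d) -> U y /\ Rabs (DF i y - DF i x) < e.
  apply: (common_radius (P := fun i d => forall y,
    (forall j, Rabs (y j - x j) < d) -> U y /\ Rabs (DF i y - DF i x) < e)).
    move=> i d d' dP [_ dd'] y yx; apply: dP => j.
    exact: Rlt_le_trans (yx j) dd'.
  move=> i; have [d1 [d10 dU]] := oU Ux; have [d2 [d20 dD]] := cDF i Ux e0.
  exists (Rmin d1 d2); split; first exact: Rmin_glb_lt.
  move=> y yx; have Uy : U y by apply: dU => j; apply: Rlt_le_trans (yx j) (Rmin_l _ _).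
  split=> //; apply: dD => // j; exact: Rlt_le_trans (yx j) (Rmin_r _ _).
exists d; split=> // y yx.
pose S (f : I -> R) s := foldr Rplus 0 (map f s).
(* Generalized to a list [s] of coordinates outside which [y] equals [x]. Resetting the head
   coordinate of [y] to its value in [x] leaves a point covered by the induction hypothesis. *)
have main s : uniq s -> forall y, (forall i, Rabs (y i - x i) < d) ->
    (forall i, i \notin s -> y i = x i) ->
    Rabs (F y - F x - S (fun i => DF i x * (y i - x i)) s)
      <= e * S (fun i => Rabs (y i - x i)) s.
  elim: s => [_|i s IH /= /andP[si us]] {yx} {}y yx ys; rewrite /S /=.
    have -> : y = x by apply: functional_extensionality => i; apply: ys.
    by rewrite !Rminus_diag Rabs_R0; lra.
  set y' := upd y i (x i).
  have y's j : j \in s -> y' j = y j.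
    by rewrite /y' /upd; case: eqP => // ->; rewrite (negbTE si).
  have y'x j : Rabs (y' j - x j) < d.
    rewrite /y' /upd; case: eqP => [->|_]; last exact: yx.
    by rewrite Rminus_diag Rabs_R0.
  have near_y h : Rmin (x i) (y i) <= h <= Rmax (x i) (y i) ->
      forall j, Rabs (upd y i h j - x j) < d.
    move=> hb j; rewrite /upd; case: eqP => [->|_]; last exact: yx.
    have := yx i; move: hb; rewrite /Rmin /Rmax; case: Rle_dec => _ hb;
    by split_Rabs; lra.
  have dg h : Rmin (x i) (y i) <= h <= Rmax (x i) (y i) ->
      derivable_pt_lim (fun h => F (upd y i h)) h (DF i (upd y i h)).
    move=> /near_y /(dP i) [Uh _]; have := pF i Uh.
    rewrite /is_partial; have -> : upd y i h i = h by rewrite /upd eqxx.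
    have -> // : (fun h0 => F (upd (upd y i h) i h0)) = (fun h0 => F (upd y i h0)).
    apply: functional_extensionality => h0; congr F.
    by apply: functional_extensionality => j; rewrite /upd; case: eqP.
  have [h [hb Fh]] : exists h, Rmin (x i) (y i) <= h <= Rmax (x i) (y i) /\
      F (upd y i (y i)) - F (upd y i (x i)) = DF i (upd y i h) * (y i - x i).
    apply: (MVT_gen (fun h => F (upd y i h))) => h hb.
      by apply/is_derive_Reals; apply: dg; lra.
    apply: derivable_continuous_pt.
    by exists (DF i (upd y i h)); apply: dg.
  have [_ DFh] := dP i _ (near_y h hb).
  rewrite upd_id -/y' in Fh.
  have y'0 j : j \notin s -> y' j = x j.
    move=> js; rewrite /y' /upd; case: eqP => [->//|/eqP ji].
    by apply: ys; rewrite inE negb_or ji.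
  have := IH us y' y'x y'0; rewrite /S.
  have -> : map (fun j => DF j x * (y' j - x j)) s = map (fun j => DF j x * (y j - x j)) s.
    by apply/eq_in_map => j /y's ->.
  have -> : map (fun j => Rabs (y' j - x j)) s = map (fun j => Rabs (y j - x j)) s.
    by apply/eq_in_map => j /y's ->.
  set A := foldr _ _ _; set B := foldr _ _ _ => IHs.
  have -> : F y - F x - (DF i x * (y i - x i) + A) =
    (DF i (upd y i h) - DF i x) * (y i - x i) + (F y' - F x - A).
    by lra.
  apply: Rle_trans (Rabs_triang _ _) _; rewrite Rabs_mult Rmult_plus_distr_l.
  apply: Rplus_le_compat IHs; apply: Rmult_le_compat_r; first exact: Rabs_pos.
  lra.
have := main (enum I) (enum_uniq _) y yx; apply=> i; by rewrite mem_enum.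
Qed.

(** The error of the difference quotient splits into the remainder of the total increment divided by
    h and the errors of the difference quotients of the [c i], weighted by the partial derivatives;
    each part is made smaller than e / 2. *)
Lemma chain_rule (c : I -> R -> R) (s : R) (c' : I -> R) :
  U (fun i => c i s) -> (forall i, derivable_pt_lim (c i) s (c' i)) ->
  derivable_pt_lim (fun t => F (fun i => c i t)) s
    (sumR (fun i => DF i (fun i => c i s) * c' i)).
Proof.
move=> Ux dc e e0; set x := fun i => c i s.
(* [K] bounds the sum of the absolute difference quotients once each is within 1 of its limit; [S]
   below is the total weight of their errors. Adding 1 in the denominators avoids division by
   zero. *)
set K := sumR (fun i => Rabs (c' i) + 1).
have K0 : 0 <= K by apply: sumR_ge0 => i; have := Rabs_pos (c' i); lra.
set S := sumR (fun i => Rabs (DF i x)).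
have S0 : 0 <= S by apply: sumR_ge0 => i; apply: Rabs_pos.
have e1 : 0 < e / (2 * (K + 1)) by apply: Rdiv_lt_0_compat; lra.
have e2 : 0 < e / (2 * (S + 1)) by apply: Rdiv_lt_0_compat; lra.
have [d [d0 dP]] := total_increment Ux e1.
have [eta [eta0 etaP]] : exists eta, 0 < eta /\ forall i h, h <> 0 -> Rabs h < eta ->
    [/\ Rabs ((c i (s + h) - c i s) / h - c' i) < 1,
        Rabs ((c i (s + h) - c i s) / h - c' i) < e / (2 * (S + 1)) &
        Rabs (c i (s + h) - c i s) < d].
  apply: (common_radius (P := fun i eta => forall h, h <> 0 -> Rabs h < eta ->
    [/\ Rabs ((c i (s + h) - c i s) / h - c' i) < 1,
        Rabs ((c i (s + h) - c i s) / h - c' i) < e / (2 * (S + 1)) &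
        Rabs (c i (s + h) - c i s) < d])).
    by move=> i eta eta' P [_ le] h h0 hh; apply: P => //; apply: Rlt_le_trans hh le.
  move=> i.
  have [[a1 a10] /= h1] := dc i 1 Rlt_0_1.
  have [[a2 a20] /= h2] := dc i _ e2.
  have B0 : 0 < Rabs (c' i) + 1 by have := Rabs_pos (c' i); lra.
  (* A quotient within 1 of [c' i] has size below [Rabs (c' i) + 1], so this bound on h keeps the
     increment of [c i] below d. *)
  have a30 : 0 < d / (Rabs (c' i) + 1) by apply: Rdiv_lt_0_compat.
  exists (Rmin a1 (Rmin a2 (d / (Rabs (c' i) + 1)))); split.
    by do !apply: Rmin_glb_lt.
  move=> h h0 hh.
  have ha1 := Rlt_le_trans _ _ _ hh (Rmin_l _ _).
  have ha := Rlt_le_trans _ _ _ hh (Rmin_r _ _).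
  have ha2 := Rlt_le_trans _ _ _ ha (Rmin_l _ _).
  have ha3 := Rlt_le_trans _ _ _ ha (Rmin_r _ _).
  have q1 := h1 h h0 ha1; split=> //; first exact: h2.
  have -> : c i (s + h) - c i s = (c i (s + h) - c i s) / h * h by field.
  have -> : d = (Rabs (c' i) + 1) * (d / (Rabs (c' i) + 1)) by field; lra.
  rewrite Rabs_mult; apply: Rmult_le_0_lt_compat => //; try exact: Rabs_pos.
  by move: q1; split_Rabs; lra.
exists (mkposreal _ eta0) => h h0 /= hh.
have /dP : forall i, Rabs (c i (s + h) - x i) < d by move=> i; case: (etaP i h h0 hh).
set R0 := _ - _ - _ => R0le.
set q := fun i => (c i (s + h) - c i s) / h.
have cq i : c i (s + h) - x i = h * q i by rewrite /q /x; field.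
have -> : (F (fun i => c i (s + h)) - F (fun i => c i s)) / h -
    sumR (fun i => DF i x * c' i) = R0 / h + sumR (fun i => DF i x * (q i - c' i)).
  have -> : sumR (fun i => DF i x * (q i - c' i)) =
      sumR (fun i => DF i x * q i) + -1 * sumR (fun i => DF i x * c' i).
    by rewrite -sumR_scal -sumR_plus; apply: sumR_ext => i; ring.
  rewrite /R0.
  have -> : sumR (fun i => DF i x * (c i (s + h) - x i)) =
      h * sumR (fun i => DF i x * q i).
    by rewrite -sumR_scal; apply: sumR_ext => i; rewrite cq; ring.
  by rewrite -/x; field.
apply: Rle_lt_trans (Rabs_triang _ _) _.
have b1 : Rabs (R0 / h) <= e / (2 * (K + 1)) * K.
  have h0' := Rabs_pos_lt _ h0.
  rewrite /Rdiv Rabs_mult Rabs_inv.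
  apply: (Rmult_le_reg_r (Rabs h)) => //.
  have -> : Rabs R0 * / Rabs h * Rabs h = Rabs R0 by field; lra.
  apply: Rle_trans R0le _; rewrite -/(Rdiv _ _) Rmult_assoc.
  apply: Rmult_le_compat_l; first lra.
  rewrite Rmult_comm -sumR_scal; apply: sumR_le => i.
  rewrite cq Rabs_mult; apply: Rmult_le_compat_l; first lra.
  by have [q1 _ _] := etaP i h h0 hh; move: q1; rewrite -/(q i); split_Rabs; lra.
have b2 : Rabs (sumR (fun i => DF i x * (q i - c' i))) <= e / (2 * (S + 1)) * S.
  apply: Rle_trans (Rabs_sumR _) _; rewrite -sumR_scal; apply: sumR_le => i.
  rewrite Rabs_mult Rmult_comm; apply: Rmult_le_compat_r; first exact: Rabs_pos.
  by have [_ q1 _] := etaP i h h0 hh; apply: Rlt_le.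
have p1 : e / (2 * (K + 1)) * K < e / 2.
  have -> : e / (2 * (K + 1)) * K = e / 2 - e / (2 * (K + 1)) by field; lra.
  lra.
have p2 : e / (2 * (S + 1)) * S < e / 2.
  have -> : e / (2 * (S + 1)) * S = e / 2 - e / (2 * (S + 1)) by field; lra.
  lra.
lra.
Qed.

End ChainRule.

(** * Composition of C^k maps *)

Section Composition.
Variables (I J : finType) (D : (I -> R) -> Prop) (U : (J -> R) -> Prop).
Hypothesis oU : open_set U.

Lemma cont_on_comp F (c : J -> (I -> R) -> R) :
  (forall x, D x -> U (fun j => c j x)) -> cont_on U F ->
  (forall j, cont_on D (c j)) -> cont_on D (fun x => F (fun j => c j x)).
Proof.
move=> DU cF cc x Dx e e0; have [d [d0 dF]] := cF _ (DU x Dx) e e0.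
have [a [a0 aP]] : exists a, 0 < a /\ forall j y, D y ->
    (forall i, Rabs (y i - x i) < a) -> Rabs (c j y - c j x) < d.
  apply: (common_radius (P := fun j a => forall y, D y ->
    (forall i, Rabs (y i - x i) < a) -> Rabs (c j y - c j x) < d)).
    move=> j a a' P [_ le] y Dy yx; apply: P => // i; exact: Rlt_le_trans (yx i) le.
  by move=> j; apply: cc.
exists a; split=> // y Dy yx; apply: dF; first exact: DU.
by move=> j; apply: aP.
Qed.

Lemma Ck_comp k F (c : J -> (I -> R) -> R) :
  (forall x, D x -> U (fun j => c j x)) -> Ck U k F ->
  (forall j, Ck D k (c j)) -> Ck D k (fun x => F (fun j => c j x)).
Proof.
move=> DU; elim: k F => [|k IH] F; first exact: cont_on_comp.
move=> CF Cc; split.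
  by apply: cont_on_comp => // [|j]; [exact: Ck_cont CF|exact: Ck_cont (Cc j)].
move: CF => [cF [DF [pF cDF]]].
have [Dc Dcp] : exists Dc : J -> I -> (I -> R) -> R, forall j,
    (forall i x, D x -> is_partial (c j) i x (Dc j i x)) /\ (forall i, Ck D k (Dc j i)).
  have ex j : exists Dcj : I -> (I -> R) -> R,
    (forall i x, D x -> is_partial (c j) i x (Dcj i x)) /\ (forall i, Ck D k (Dcj i))
    by case: (Cc j).
  exists (fun j => sval (constructive_indefinite_description _ (ex j))) => j.
  exact: svalP (constructive_indefinite_description _ (ex j)).
exists (fun i x => sumR (fun j => DF j (fun j => c j x) * Dc j i x)).
split=> [i x Dx|i].
  have dc j : derivable_pt_lim (fun h => c j (upd x i h)) (x i) (Dc j i x).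
    by have [pc _] := Dcp j; apply: pc.
  have Ux : U (fun j => c j (upd x i (x i))) by rewrite upd_id; apply: DU.
  have := chain_rule oU pF (fun j => Ck_cont (cDF j))
    (c := fun j h => c j (upd x i h)) Ux dc.
  by rewrite upd_id.
apply: Ck_sum => j; apply: Ck_mult.
  exact: IH (cDF j) (fun j => Ck_pred (Cc j)).
by have [_ Cj] := Dcp j; apply: Cj.
Qed.

End Composition.

(** * Functions of one variable *)

Notation interval a b := (fun x : unit -> R => a < x tt < b).
Definition smooth1 (a b : R) (f : R -> R) :=
  smooth_on (interval a b) (fun x : unit -> R => f (x tt)).

Lemma open_interval a b : open_set (interval a b).
Proof.
move=> x [ax xb]; exists (Rmin (x tt - a) (b - x tt)).
split; first by apply: Rmin_glb_lt; lra.
move=> y /(_ tt) yx.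
have := Rlt_le_trans _ _ _ yx (Rmin_l _ _).
have := Rlt_le_trans _ _ _ yx (Rmin_r _ _).
by split_Rabs; lra.
Qed.

Lemma derivable_pt_lim_continuity f x l : derivable_pt_lim f x l -> continuity_pt f x.
Proof. by move=> df; apply: derivable_continuous_pt; exists l. Qed.

Lemma cont_on_interval a b (f : R -> R) :
  cont_on (interval a b) (fun x => f (x tt)) <->
  (forall t, a < t < b -> continuity_pt f t).
Proof.
split=> [cf t tab|cf x xab e e0].
  apply/continuity_pt_locally => e.
  have [d [d0 dP]] := cf (fun=> t) tab e (cond_pos e).
  have d'0 : 0 < Rmin d (Rmin (t - a) (b - t)) by do !apply: Rmin_glb_lt; lra.
  exists (mkposreal _ d'0) => u; rewrite /ball /= /AbsRing_ball /abs /minus /plus /opp /=.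
  move=> ut.
  have u1 := Rlt_le_trans _ _ _ ut (Rmin_l _ _).
  have u2 := Rlt_le_trans _ _ _ ut (Rmin_r _ _).
  have u3 := Rlt_le_trans _ _ _ u2 (Rmin_l _ _).
  have u4 := Rlt_le_trans _ _ _ u2 (Rmin_r _ _).
  apply: (dP (fun=> u)); last by move=> _.
  by move: u3 u4; split_Rabs; lra.
have /continuity_pt_locally /(_ (mkposreal _ e0)) [d dP] := cf _ xab.
exists d; split; first exact: cond_pos.
by move=> y _ /(_ tt) yx; apply: dP.
Qed.

Lemma smooth1_continuity a b f t : smooth1 a b f -> a < t < b -> continuity_pt f t.
Proof. by move=> /(_ O) /cont_on_interval; apply. Qed.

(** The bootstrap for differential equations: regularity of the right-hand side gives one more order
    to the solution. *)
Lemma Ck_primitive a b k (f g : R -> R) :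
  (forall t, a < t < b -> derivable_pt_lim f t (g t)) ->
  Ck (interval a b) k (fun x => g (x tt)) ->
  Ck (interval a b) k.+1 (fun x => f (x tt)).
Proof.
move=> df Cg; split.
  by apply/cont_on_interval => t /df; apply: derivable_pt_lim_continuity.
by exists (fun _ x => g (x tt)); split=> // -[] x /df.
Qed.

Lemma continuity_bounded f a b : a <= b ->
  (forall t, a <= t <= b -> continuity_pt f t) ->
  exists B, 0 <= B /\ forall t, a <= t <= b -> Rabs (f t) <= B.
Proof.
move=> ab cf.
have [m [mP mab]] : exists m, (forall t, a <= t <= b -> Rabs (f t) <= Rabs (f m)) /\ a <= m <= b.
  apply: (continuity_ab_maj (fun t => Rabs (f t))) => // t /cf cft.
  apply: (continuity_pt_comp f Rabs) => //; exact: Rcontinuity_abs.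
by exists (Rabs (f m)); split=> //; apply: Rabs_pos.
Qed.

(** Both [g - f] and [g + f] have nonnegative derivative, hence do not decrease from a to b. *)
Lemma derivative_dominated (f f' g g' : R -> R) a b : a <= b ->
  (forall t, a <= t <= b -> derivable_pt_lim f t (f' t)) ->
  (forall t, a <= t <= b -> derivable_pt_lim g t (g' t)) ->
  (forall t, a <= t <= b -> Rabs (f' t) <= g' t) ->
  Rabs (f b - f a) <= g b - g a.
Proof.
move=> ab df dg fg.
have mono (h h' : R -> R) : (forall t, a <= t <= b -> derivable_pt_lim h t (h' t)) ->
    (forall t, a <= t <= b -> 0 <= h' t) -> h a <= h b.
  move=> dh h0.
  have [c [cab hc]] : exists c, Rmin a b <= c <= Rmax a b /\ h b - h a = h' c * (b - a).
    rewrite Rmin_left // Rmax_right //.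
    have := @MVT_gen h a b h'; rewrite Rmin_left // Rmax_right //; apply.
      by move=> t tab; apply/is_derive_Reals; apply: dh; lra.
    by move=> t tab; apply: derivable_pt_lim_continuity (dh t tab).
  rewrite Rmin_left // Rmax_right // in cab.
  have := Rmult_le_pos _ _ (h0 c cab); move=> /(_ (b - a)); lra.
have m1 := mono (fun t => g t - f t) _
  (fun t tab => derivable_pt_lim_minus _ _ _ _ _ (dg t tab) (df t tab)).
have m2 := mono (fun t => g t + f t) _
  (fun t tab => derivable_pt_lim_plus _ _ _ _ _ (dg t tab) (df t tab)).
have {}m1 := m1 (fun t tab => ltac:(have := fg t tab; split_Rabs; lra)).
have {}m2 := m2 (fun t tab => ltac:(have := fg t tab; split_Rabs; lra)).
by split_Rabs; lra.
Qed.

(** Comparison with a primitive of c |u - s|^k. The sign e = 1 or -1 in [dpow] replaces the absolute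
    value by e (u - s), one sign for each side of s. *)
Lemma derivative_power_bound (f f' : R -> R) s t c k : f s = 0 ->
  (forall u, Rmin s t <= u <= Rmax s t ->
     derivable_pt_lim f u (f' u) /\ Rabs (f' u) <= c * Rabs (u - s) ^ k) ->
  Rabs (f t) <= c * (Rabs (t - s) ^ k.+1 / INR k.+1).
Proof.
move=> fs df.
have k0 : INR k.+1 <> 0 by apply: not_0_INR.
have dpow (e u : R) : e * e = 1 ->
    derivable_pt_lim (fun u => e * c * ((e * (u - s)) ^ k.+1 / INR k.+1)) u
      (c * (e * (u - s)) ^ k).
  move=> ee; have -> : c * (e * (u - s)) ^ k =
    e * c * ((INR k.+1 * e * (e * (u - s)) ^ k) / INR k.+1).
    have -> : e * c * (INR k.+1 * e * (e * (u - s)) ^ k / INR k.+1) =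
      (e * e) * (c * (e * (u - s)) ^ k) by field.
    by rewrite ee; ring.
  apply/is_derive_Reals; auto_derive => //.
  rewrite -[X in _ * (X * _) * _]/(INR k.+1) -[X in _ * / X]/(INR k.+1) /Rminus /Rdiv; ring.
have p0 e : (e * (s - s)) ^ k.+1 = 0 by rewrite Rminus_diag Rmult_0_r pow_ne_zero.
have [st|ts] := Rle_dec s t.
  rewrite Rmin_left // Rmax_right // in df.
  have := derivative_dominated st (fun u su => proj1 (df u su))
    (fun u _ => dpow 1 u ltac:(ring)).
  rewrite p0 fs Rminus_0_r Rdiv_0_l Rmult_0_r Rminus_0_r !Rmult_1_l.
  rewrite [Rabs (t - s)]Rabs_right; last by lra.
  apply=> u su; rewrite Rmult_1_l; have [_] := df u su.
  by rewrite [Rabs (u - s)]Rabs_right //; lra.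
have {}ts : t <= s by lra.
rewrite Rmin_right // Rmax_left // in df.
have := derivative_dominated ts (fun u su => proj1 (df u su))
  (fun u _ => dpow (-1) u ltac:(ring)).
rewrite p0 fs Rdiv_0_l Rmult_0_r.
have -> (x : R) : Rabs (0 - x) = Rabs x by split_Rabs; lra.
have -> : -1 * (t - s) = Rabs (t - s) by split_Rabs; lra.
have -> (x : R) : 0 - -1 * c * x = c * x by ring.
apply=> u su; have [_] := df u su.
by have -> : -1 * (u - s) = Rabs (u - s) by split_Rabs; lra.
Qed.

(** * Linear differential equations *)

(** The increments of [u] telescope against those of [s], so [u] is Cauchy and its distance to the
    limit is at most the tail [A - s n], a rate that does not depend on [u]. *)
Lemma dominated_increments_cv (u s : nat -> R) A :
  (forall n, Rabs (u n.+1 - u n) <= s n.+1 - s n) -> Un_cv s A ->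
  exists l, Un_cv u l /\ forall n, Rabs (l - u n) <= A - s n.
Proof.
move=> us sA.
have us' n m : Rabs (u (m + n)%coq_nat - u n) <= s (m + n)%coq_nat - s n.
  elim: m => [|m IH] /=; first by rewrite !Rminus_diag Rabs_R0; lra.
  by have := us (m + n)%coq_nat; move: IH; split_Rabs; lra.
have us2 n m : (n <= m)%coq_nat -> Rabs (u m - u n) <= s m - s n.
  by move=> nm; have := us' n (m - n)%coq_nat; rewrite Nat.sub_add.
have /Rcomplete.R_complete [l ul] : Cauchy_crit u.
  move=> e /(CV_Cauchy _ (exist _ A sA)) [N NP]; exists N => n m nN mN.
  have := NP n m nN mN; rewrite /Rdist.
  have [nm|mn] := Nat.le_ge_cases n m.
    by have := us2 n m nm; split_Rabs; lra.
  by have := us2 m n mn; split_Rabs; lra.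
exists l; split=> // n.
apply: Rnot_lt_le => lt.
have e0 : 0 < (Rabs (l - u n) - (A - s n)) / 2 by lra.
have [N1 P1] := ul _ e0; have [N2 P2] := sA _ e0.
set m := Nat.max n (Nat.max N1 N2).
have h1 := us2 n m (Nat.le_max_l _ _).
have h2 := P1 m (Nat.le_trans _ _ _ (Nat.le_max_l _ _) (Nat.le_max_r _ _)).
have h3 := P2 m (Nat.le_trans _ _ _ (Nat.le_max_r _ _) (Nat.le_max_r _ _)).
by move: h1 h2 h3 lt; rewrite /Rdist; split_Rabs; lra.
Qed.

Lemma derivable_RInt f a b s t : a < s < b -> a < t < b ->
  (forall u, a < u < b -> continuity_pt f u) ->
  derivable_pt_lim (fun t => RInt f s t) t (f t).
Proof.
move=> sab tab cf; apply/is_derive_Reals.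
have d0 : 0 < Rmin (t - a) (b - t) by apply: Rmin_glb_lt; lra.
apply: is_derive_RInt; last by apply/continuity_pt_filterlim; apply: cf.
exists (mkposreal _ d0) => u; rewrite /ball /= /AbsRing_ball /abs /minus /plus /opp /= => ut.
have u1 := Rlt_le_trans _ _ _ ut (Rmin_l _ _).
have u2 := Rlt_le_trans _ _ _ ut (Rmin_r _ _).
have uab : a < u < b by move: u1 u2; split_Rabs; lra.
apply: RInt_correct; apply: ex_RInt_continuous => v vsu.
apply/continuity_pt_filterlim; apply: cf.
by move: vsu; rewrite /Rmin /Rmax; case: Rle_dec => _; lra.
Qed.

Lemma continuity_pt_sumR (J : finType) (f : J -> R -> R) x :
  (forall j, continuity_pt (f j) x) -> continuity_pt (fun t => sumR (f^~ t)) x.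
Proof.
move=> cf; rewrite /sumR; elim: (enum J) => [|j s IH] /=.
  exact: continuity_pt_const.
exact: continuity_pt_plus (cf j) IH.
Qed.

(** * Picard iteration with explicit error bounds *)

Section Picard.
Variables (I : finType) (M : I -> I -> R -> R) (f : I -> R -> R).
Variables (a b s lam C : R) (x0 : I -> R).
Hypothesis sab : a < s < b.
Hypothesis cM : forall i j t, a < t < b -> continuity_pt (M i j) t.
Hypothesis cf : forall i t, a < t < b -> continuity_pt (f i) t.
Hypothesis lam0 : 0 < lam.
Hypothesis C0 : 0 <= C.
Hypothesis M_le : forall i t, a < t < b -> sumR (fun j => Rabs (M i j t)) <= lam.
Hypothesis f_le : forall i t, a < t < b ->
  Rabs (sumR (fun j => M i j t * x0 j) + f i t) <= C.

Let field (x : I -> R) i t := sumR (fun j => M i j t * x j) + f i t.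

Fixpoint picard n i t :=
  match n with
  | 0%N => x0 i
  | m.+1 => x0 i + RInt (fun u => field (fun j => picard m j u) i u) s t
  end.

(** An iterate is differentiable, as an integral, only if its predecessor is continuous, and its own
    continuity follows from differentiability; hence the joint induction. *)
Lemma picard_continuity_derive n :
  (forall i t, a < t < b -> continuity_pt (picard n i) t) /\
  (forall i t, a < t < b ->
     derivable_pt_lim (picard n.+1 i) t (field (fun j => picard n j t) i t)).
Proof.
have derive m : (forall i t, a < t < b -> continuity_pt (picard m i) t) ->
    forall i t, a < t < b ->
    derivable_pt_lim (picard m.+1 i) t (field (fun j => picard m j t) i t).
  move=> cm i t tab; rewrite -[field _ _ _]Rplus_0_l.
  apply: derivable_pt_lim_plus; first exact: derivable_pt_lim_const.
  apply: (@derivable_RInt (fun u => field (fun j => picard m j u) i u) a b) => // u uab.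
  apply: continuity_pt_plus; last exact: cf.
  apply: continuity_pt_sumR => j; apply: continuity_pt_mult; [exact: cM|exact: cm].
elim: n => [|n [_ IH]].
  have c0 : forall i t, a < t < b -> continuity_pt (picard 0 i) t.
    by move=> i t _; apply: continuity_pt_const.
  by split=> //; apply: derive.
have cn : forall i t, a < t < b -> continuity_pt (picard n.+1 i) t.
  by move=> i t tab; apply: derivable_pt_lim_continuity (IH i t tab).
by split=> //; apply: derive.
Qed.

Lemma picard_initial n i : picard n i s = x0 i.
Proof. by case: n => //= n; rewrite RInt_point /zero /= Rplus_0_r. Qed.

Lemma field_diff x y i t B : a < t < b -> (forall j, Rabs (x j - y j) <= B) ->
  Rabs (field x i t - field y i t) <= lam * B.
Proof.
move=> tab xy.
have -> : field x i t - field y i t = sumR (fun j => M i j t * (x j - y j)).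
  rewrite /field; have -> : sumR (fun j => M i j t * (x j - y j)) =
    sumR (fun j => M i j t * x j) + -1 * sumR (fun j => M i j t * y j).
    by rewrite -sumR_scal -sumR_plus; apply: sumR_ext => j; ring.
  by ring.
apply: Rle_trans (Rabs_sumR _) _.
have B0 : 0 <= B by apply: Rle_trans (xy i); apply: Rabs_pos.
apply: Rle_trans (Rmult_le_compat_r _ _ _ B0 (M_le i tab)).
rewrite Rmult_comm -sumR_scal; apply: sumR_le => j; rewrite Rabs_mult Rmult_comm.
by apply: Rmult_le_compat_r (xy j); apply: Rabs_pos.
Qed.

Lemma between_in t u : a < t < b -> Rmin s t <= u <= Rmax s t -> a < u < b.
Proof. by move=> tab; rewrite /Rmin /Rmax; case: Rle_dec => _; lra. Qed.

(** [C] bounds the velocity at the constant curve [x0]. Each further iteration contributes a factor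
    [lam] and one integration of a power of |t - s|, which produces the factorial. *)
Lemma picard_step n i t : a < t < b ->
  Rabs (picard n.+1 i t - picard n i t)
    <= C * lam ^ n / INR (fact n.+1) * Rabs (t - s) ^ n.+1.
Proof.
elim: n i t => [|n IH] i t tab.
  have := @derivative_power_bound (fun t => picard 1 i t - x0 i)
    (fun t => field x0 i t) s t C 0.
  rewrite (picard_initial 1) Rminus_diag => /(_ erefl) H.
  apply: Rle_trans (H _) _ => [u /(between_in tab) uab|].
    split; last by rewrite /= Rmult_1_r; apply: f_le.
    have [_ /(_ i u uab) d] := picard_continuity_derive 0.
    rewrite -[field _ _ _]Rminus_0_r; apply: derivable_pt_lim_minus d _.
    exact: derivable_pt_lim_const.
  by rewrite /=; right; field.
set c := C * lam ^ n.+1 / INR (fact n.+1).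
have := @derivative_power_bound (fun t => picard n.+2 i t - picard n.+1 i t)
  (fun t => field (fun j => picard n.+1 j t) i t - field (fun j => picard n j t) i t)
  s t c n.+1.
rewrite (picard_initial n.+2) (picard_initial n.+1) Rminus_diag => /(_ erefl) H.
apply: Rle_trans (H _) _ => [u /(between_in tab) uab|].
  split.
    have [_ /(_ i u uab) d1] := picard_continuity_derive n.+1.
    have [_ /(_ i u uab) d2] := picard_continuity_derive n.
    exact: derivable_pt_lim_minus d1 d2.
  apply: Rle_trans (field_diff i uab (fun j => IH j u uab)) _.
  by right; rewrite /c; have := INR_fact_neq_0 n.+1; simpl pow; move=> ?; field.
right; rewrite /c [in RHS]fact_simpl mult_INR; field.
split; [exact: INR_fact_neq_0|exact: not_0_INR].
Qed.

Lemma picard_limit : exists X : I -> R -> R, exists B : nat -> R,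
  [/\ Un_cv B 0,
      forall i t, a < t < b -> Un_cv (fun n => picard n i t) (X i t) &
      forall n i t, a < t < b -> Rabs (X i t - picard n i t) <= B n].
Proof.
set T := b - a.
(* The bound on the n-th step equals C / lam times the term of index n + 1 of the exponential series
   at lam T, whence the factor C / lam. *)
set sm := fun n => C / lam * sum_f_R0 (fun k => / INR (fact k) * (lam * T) ^ k) n.
set A := C / lam * exp (lam * T).
have smA : Un_cv sm A.
  apply: CV_mult; last by move=> e e0; apply: (proj2_sig (exist_exp (lam * T))).
  by move=> e e0; exists 0%N => n _; rewrite Rdist_eq.
have ex i t : a < t < b -> exists l, Un_cv (fun n => picard n i t) l /\
    forall n, Rabs (l - picard n i t) <= A - sm n.
  move=> tab; apply: dominated_increments_cv smA => n.
  apply: Rle_trans (picard_step n i tab) _.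
  have -> : sm n.+1 - sm n = C * lam ^ n / INR (fact n.+1) * T ^ n.+1.
    rewrite /sm tech5 Rpow_mult_distr; simpl pow; field.
    by split; [exact: INR_fact_neq_0|lra].
  apply: Rmult_le_compat_l.
    apply: Rmult_le_pos; last by apply/Rlt_le/Rinv_0_lt_compat/INR_fact_lt_0.
    by apply: Rmult_le_pos C0 _; apply: pow_le; lra.
  apply: pow_incr; split; first exact: Rabs_pos.
  by rewrite /T; split_Rabs; lra.
(* Choice needs a value at every t; outside (a, b) it is 0. *)
have ex' i t : exists l, a < t < b -> Un_cv (fun n => picard n i t) l /\
    forall n, Rabs (l - picard n i t) <= A - sm n.
  have [tab|ntab] := excluded_middle_informative (a < t < b); last by exists 0.
  by have [l lP] := ex i t tab; exists l.
exists (fun i t => sval (constructive_indefinite_description _ (ex' i t))).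
exists (fun n => A - sm n); split.
- move=> e e0; have [N NP] := smA e e0; exists N => n /NP.
  by rewrite /Rdist; split_Rabs; lra.
- by move=> i t tab; case: (svalP (constructive_indefinite_description _ (ex' i t)) tab).
- by move=> n i t tab; case: (svalP (constructive_indefinite_description _ (ex' i t)) tab).
Qed.

(** The derivatives of the iterates converge uniformly, by the uniform error [B n] and the Lipschitz
    bound of [field], so the limit may be differentiated termwise. *)
Lemma picard_solution : exists X : I -> R -> R,
  (forall i, X i s = x0 i) /\
  (forall i t, a < t < b -> derivable_pt_lim (X i) t (field (fun j => X j t) i t)).
Proof.
have [X [B [B0 Xcv XB]]] := picard_limit.
exists X; split=> [i|i t tab].
  apply: (UL_sequence _ _ _ (Xcv i s sab)) => e e0; exists 0%N => n _.
  by rewrite picard_initial Rdist_eq.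
have r0 : 0 < (b - a) / 2 by lra.
(* Uniform convergence [CVU] is stated on balls, so (a, b) is written as the ball around its
   midpoint. *)
set r := mkposreal _ r0; set c := (a + b) / 2.
have inab y : Boule c r y <-> a < y < b.
  by rewrite /Boule /c /r /=; split=> [|?]; split_Rabs; lra.
pose rhs n t := field (fun j => picard n j t) i t.
have cvu : CVU rhs (fun t => field (fun j => X j t) i t) c r.
  move=> e e0; have e1 : 0 < e / lam by apply: Rdiv_lt_0_compat.
  have [N NP] := B0 _ e1; exists N => n y nN /inab yab.
  apply: Rle_lt_trans (field_diff i yab (fun j => XB n j y yab)) _.
  have := NP n nN; rewrite /Rdist Rminus_0_r => Bn.
  have -> : e = lam * (e / lam) by field; lra.
  by apply: Rmult_lt_compat_l => //; move: Bn; split_Rabs; lra.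
(* The index is shifted by one: [rhs n] is the derivative of iterate n + 1. *)
apply: (derivable_pt_lim_CVU (fun n => picard n.+1 i) rhs (X i)
  (fun t => field (fun j => X j t) i t) t c r).
- by apply/inab.
- by move=> y n /inab yab; have [_ d] := picard_continuity_derive n; apply: d.
- by move=> y /inab yab e e0; have [N NP] := Xcv i y yab e e0; exists N => n nN;
    apply: NP; apply: Nat.le_trans nN (Nat.le_succ_diag_r _).
- exact: cvu.
- apply: CVU_continuity cvu _ => n y /inab yab.
  apply: continuity_pt_plus; last exact: cf.
  apply: continuity_pt_sumR => j; apply: continuity_pt_mult; first exact: cM.
  by have [cn _] := picard_continuity_derive n; apply: cn.
Qed.

End Picard.

(** The coefficients are bounded on [a', b'], a compact part of (a, b), which supplies the constants
    of the Picard scheme. The equation then raises the order of differentiability of the solution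
    one step at a time. *)
Lemma linear_ode (I : finType) (M : I -> I -> R -> R) (f : I -> R -> R)
    a b a' b' s (x0 : I -> R) : a < a' -> b' < b -> a' < s < b' ->
  (forall i j, smooth1 a b (M i j)) -> (forall i, smooth1 a b (f i)) ->
  exists X : I -> R -> R, [/\ forall i, X i s = x0 i,
    forall i t, a' < t < b' ->
      derivable_pt_lim (X i) t (sumR (fun j => M i j t * X j t) + f i t) &
    forall i, smooth1 a' b' (X i)].
Proof.
move=> aa bb sab sM sf.
have bound h : (forall t, a < t < b -> continuity_pt h t) ->
    exists B, 0 <= B /\ forall t, a' < t < b' -> Rabs (h t) <= B.
  move=> ch; have [|t tab|B [B0 hB]] := @continuity_bounded h a' b'; first lra.
    by apply: ch; lra.
  by exists B; split=> // t tab; apply: hB; lra.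
have cM i j t : a < t < b -> continuity_pt (M i j) t by apply: smooth1_continuity.
have cf i t : a < t < b -> continuity_pt (f i) t by apply: smooth1_continuity.
have bounds (h : I -> R -> R) : (forall i t, a < t < b -> continuity_pt (h i) t) ->
    exists B, 0 <= B /\ forall i t, a' < t < b' -> Rabs (h i t) <= B.
  move=> ch; pose Bi i := constructive_indefinite_description _ (bound (h i) (ch i)).
  exists (sumR (fun i => sval (Bi i))); split.
    by apply: sumR_ge0 => i; case: (svalP (Bi i)).
  move=> i t tab; have [_ /(_ t tab) hB] := svalP (Bi i).
  apply: Rle_trans hB _; apply: (le_sumR (f := fun i => sval (Bi i))) => j.
  by case: (svalP (Bi j)).
have [lam [lam0 M_le]] := bounds (fun i t => sumR (fun j => Rabs (M i j t)))
  (fun i t tab => continuity_pt_sumR (fun j =>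
    continuity_pt_comp (M i j) Rabs t (cM i j t tab) (Rcontinuity_abs _))).
have [C [C0 f_le]] := bounds (fun i t => sumR (fun j => M i j t * x0 j) + f i t)
  (fun i t tab => continuity_pt_plus _ _ _ (continuity_pt_sumR (fun j =>
    continuity_pt_mult _ _ _ (cM i j t tab) (continuity_pt_const (fun=> x0 j) t
      (fun _ _ => erefl)))) (cf i t tab)).
have in_ab t : a' < t < b' -> a < t < b by lra.
(* The bound may be zero, while the Picard estimates divide by it. *)
have lam1 : 0 < lam + 1 by lra.
have M_le' i t : a' < t < b' -> sumR (fun j => Rabs (M i j t)) <= lam + 1.
  by move=> tab; have := M_le i t tab; split_Rabs; lra.
have [X [Xs dX]] := picard_solution sab (fun i j t tab => cM i j t (in_ab t tab))
  (fun i t tab => cf i t (in_ab t tab)) lam1 C0 M_le' f_le.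
exists X; split=> // i k.
have sub h n : smooth1 a b h -> Ck (interval a' b') n (fun x => h (x tt)).
  by move=> sh; apply: Ck_sub (sh n) => x; lra.
elim: k i => [|k IH] i.
  by apply/cont_on_interval => t tab; apply: derivable_pt_lim_continuity (dX i t tab).
apply: Ck_primitive (dX i) _; apply: Ck_plus (sub _ _ (sf i)).
apply: (Ck_sum (F := fun j (x : unit -> R) => M i j (x tt) * X j (x tt))) => j.
exact: Ck_mult (sub _ _ (sM i j)) (IH j).
Qed.

(** * Orthogonal residuals *)

Section Orthogonalization.
Variables (T : Type) (S : (T -> R) -> Prop) (b : (T -> R) -> (T -> R) -> R).
Let comb (u : T -> R) (k : R) (w : T -> R) : T -> R := fun t => u t + k * w t.
Hypothesis S_comb : forall u k w, S u -> S w -> S (comb u k w).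
Hypothesis b_comb : forall u k w x, S u -> S w -> S x ->
  b (comb u k w) x = b u x + k * b w x.
Hypothesis b_sym : forall u w, b u w = b w u.
Hypothesis b_ge0 : forall u, S u -> 0 <= b u u.

(** If [b u u = 0], positivity forces [b v u = 0] as in the Cauchy-Schwarz inequality, and any k
    will do; otherwise k is the usual projection coefficient. *)
Lemma semi_inner_split u v : S u -> S v -> exists k, b v u + k * b u u = 0.
Proof.
move=> Su Sv; have [uu|uu] := Req_dec (b u u) 0; last first.
  by exists (- b v u / b u u); field.
exists 0; rewrite uu; have [->|vu] := Req_dec (b v u) 0; first by ring.
(* With this k the vector v + k u would have square -1. *)
exfalso; set k := - (b v v + 1) / (2 * b v u).
have := b_ge0 (S_comb k Sv Su).
rewrite b_comb ?[b v (comb _ _ _)]b_sym ?[b u (comb _ _ _)]b_sym ?b_comb //;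
  try exact: S_comb.
rewrite uu [b u v]b_sym.
have -> : b v v + k * b v u + k * (b v u + k * 0) = -1 by rewrite /k; field.
lra.
Qed.

(* Membership of [u] in [v + span w] is expressed by the closure property in P. *)
Lemma orthogonal_complement (I : eqType) (w : I -> T -> R) (s : seq I) v :
  (forall i, S (w i)) -> S v ->
  exists u, (forall P : (T -> R) -> Prop, P v ->
      (forall x k i, i \in s -> P x -> P (comb x k (w i))) -> P u) /\
    forall i, i \in s -> b u (w i) = 0.
Proof.
move=> Sw; elim: s v => [|i s IH] v Sv; first by exists v; split=> // P.
(* Gram-Schmidt: both [w i] and [v] are first made orthogonal to the remaining vectors, then [v'] is
   corrected along [u']. *)
have [u' [u'P u'0]] := IH _ (Sw i); have [v' [v'P v'0]] := IH _ Sv.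
have Su' : S u' by apply: u'P => // x k j _ Sx; apply: S_comb.
have Sv' : S v' by apply: v'P => // x k j _ Sx; apply: S_comb.
have [k vk] := semi_inner_split Su' Sv'.
have Su := S_comb k Sv' Su'.
exists (comb v' k u'); split=> [P Pv Pcomb|].
  have Pv' : P v'.
    by apply: v'P => // x h j js; apply: Pcomb; rewrite inE js orbT.
  apply: (u'P (fun x => P (comb v' k x))).
    by apply: Pcomb => //; rewrite inE eqxx.
  move=> x h j js Px.
  have -> : comb v' k (comb x h (w j)) = comb (comb v' k x) (k * h) (w j).
    by apply: functional_extensionality => t; rewrite /comb; ring.
  by apply: Pcomb => //; rewrite inE js orbT.
have us j : j \in s -> b (comb v' k u') (w j) = 0.
  by move=> js; rewrite b_comb // v'0 // u'0 //; ring.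
move=> j; rewrite inE => /orP[/eqP->|/us//].
(* [u'] differs from [w i] only by a combination of vectors already orthogonal to the result, so
   orthogonality to [u'] is orthogonality to [w i]. *)
have [_ <-] : S u' /\ b (comb v' k u') u' = b (comb v' k u') (w i).
  apply: (u'P (fun x => S x /\ b (comb v' k u') x = b (comb v' k u') (w i))) => //.
  move=> x h l ls [Sx <-]; split; first exact: S_comb.
  by rewrite ![b (comb v' _ _) _]b_sym b_comb // [b (w l) _]b_sym us //; ring.
by rewrite b_comb.
Qed.

End Orthogonalization.

(** * Integrals of continuous functions on a compact interval *)

Section Integrals.
Variables (a b : R).
Hypothesis ab : a < b.
Implicit Types f g : R -> R.
Let cont f := forall t, a <= t <= b -> continuity_pt f t.

Lemma ex_RInt_cont f : cont f -> ex_RInt f a b.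
Proof.
move=> cf; apply: ex_RInt_continuous => t; rewrite Rmin_left ?Rmax_right; try lra.
by move=> tab; apply/continuity_pt_filterlim/cf.
Qed.

Lemma RInt_derivative f f' :
  (forall t, a <= t <= b -> derivable_pt_lim f t (f' t)) -> cont f' ->
  RInt f' a b = f b - f a.
Proof.
move=> df cf'; apply: is_RInt_unique.
apply: is_RInt_derive => t; rewrite Rmin_left ?Rmax_right; try lra; move=> tab.
  by apply/is_derive_Reals/df.
by apply/continuity_pt_filterlim/cf'.
Qed.

Lemma RInt_lin f g k : cont f -> cont g ->
  RInt (fun t => f t + k * g t) a b = RInt f a b + k * RInt g a b.
Proof.
move=> /ex_RInt_cont ef /ex_RInt_cont eg.
rewrite (RInt_plus f (fun t => scal k (g t))) ?RInt_scal //.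
exact: ex_RInt_scal.
Qed.

(** A positive value at t keeps f above f t / 2 on a nondegenerate interval near t, clipped to
    [a, b] so that the end-points are covered too; its share of the integral would be positive. *)
Lemma RInt_nonneg_eq0 f : cont f -> (forall t, a <= t <= b -> 0 <= f t) ->
  RInt f a b = 0 -> forall t, a <= t <= b -> f t = 0.
Proof.
move=> cf f0 If t tab; apply: Rle_antisym; last exact: f0.
apply: Rnot_lt_le => ft.
have ft2 : 0 < f t / 2 by lra.
have /continuity_pt_locally /(_ (mkposreal _ ft2)) [[d d0] /= dP] := cf t tab.
set u := Rmax a (t - d / 2); set v := Rmin b (t + d / 2).
have [au uv vb] : [/\ a <= u, u < v & v <= b].
  split; [exact: Rmax_l| |exact: Rmin_l].
  by rewrite /u /v; apply: Rmax_lub_lt; apply: Rmin_glb_lt; lra.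
have fuv s : u <= s <= v -> f t / 2 <= f s.
  move=> [us sv].
  have h1 := Rle_trans _ _ _ (Rmax_r _ _) us; have h2 := Rle_trans _ _ _ sv (Rmin_r _ _).
  have : Rabs (f s - f t) < f t / 2.
    apply: dP; rewrite /ball /= /AbsRing_ball /abs /minus /plus /opp /=.
    by split_Rabs; lra.
  by split_Rabs; lra.
have ei c e : a <= c -> c <= e -> e <= b -> ex_RInt f c e.
  move=> ac ce eb; apply: ex_RInt_continuous => s; rewrite Rmin_left ?Rmax_right; try lra.
  by move=> sce; apply/continuity_pt_filterlim; apply: cf; lra.
have ge0 c e : a <= c -> c <= e -> e <= b -> 0 <= RInt f c e.
  move=> ac ce eb; apply: RInt_ge_0 => //; first exact: ei.
  by move=> s sce; apply: f0; lra.
have ub : u <= b by lra.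
have av : a <= v by lra.
have uv' := Rlt_le _ _ uv.
have : RInt f a b = RInt f a u + (RInt f u v + RInt f v b).
  have := RInt_Chasles f a u b (ei _ _ (Rle_refl _) au ub) (ei _ _ au ub (Rle_refl _)).
  have := RInt_Chasles f u v b (ei _ _ au uv' vb) (ei _ _ av vb (Rle_refl _)).
  by rewrite /plus /= => -> ->.
have : (v - u) * (f t / 2) <= RInt f u v.
  have -> : (v - u) * (f t / 2) = RInt (fun=> f t / 2) u v by rewrite RInt_const.
  apply: RInt_le; [lra|exact: ex_RInt_const|by apply: ei; lra|].
  by move=> s suv; apply: fuv; lra.
have := Rmult_lt_0_compat (v - u) (f t / 2).
have := ge0 a u; have := ge0 v b; lra.
Qed.

End Integrals.

(** The left side is the derivative of p.x along the adjoint and the controlled equation; the two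
    terms in A cancel, since one matrix is minus the transpose of the other. *)
Lemma adjoint_pairing (I K : finType) (A : I -> I -> R) (B : I -> K -> R)
    (l p x : I -> R) (g : K -> R) :
  sumR (fun i => (sumR (fun k => - A k i * p k) + l i) * x i +
                 p i * (sumR (fun k => A i k * x k) + sumR (fun c => B i c * g c))) =
  sumR (fun i => l i * x i) + sumR (fun c => sumR (fun i => p i * B i c) * g c).
Proof.
have -> : sumR (fun c => sumR (fun i => p i * B i c) * g c) =
    sumR (fun i => p i * sumR (fun c => B i c * g c)).
  transitivity (sumR (fun c => sumR (fun i => p i * (B i c * g c)))).
    by apply: sumR_ext => c; rewrite Rmult_comm -sumR_scal; apply: sumR_ext => i; ring.
  by rewrite sumR_exchange; apply: sumR_ext => i; rewrite sumR_scal.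
have Axp : sumR (fun i => sumR (fun k => - A k i * p k) * x i) =
    -1 * sumR (fun i => p i * sumR (fun k => A i k * x k)).
  transitivity (sumR (fun i => sumR (fun k => - A k i * p k * x i))).
    by apply: sumR_ext => i; rewrite Rmult_comm -sumR_scal; apply: sumR_ext => k; ring.
  rewrite sumR_exchange -sumR_scal; apply: sumR_ext => i.
  by rewrite -!sumR_scal; apply: sumR_ext => k; ring.
transitivity (sumR (fun i => l i * x i) + sumR (fun i => p i * sumR (fun c => B i c * g c))
  + (sumR (fun i => sumR (fun k => - A k i * p k) * x i) +
     sumR (fun i => p i * sumR (fun k => A i k * x k)))).
  by rewrite -!sumR_plus; apply: sumR_ext => i; ring.
rewrite Axp; ring.
Qed.

(** * Multipliers of linear control systems *)

Section Smooth1.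
Variables a b : R.
Implicit Types f g : R -> R.

Lemma smooth1_const c : smooth1 a b (fun=> c).
Proof. by move=> k; apply: Ck_const. Qed.

Lemma smooth1_plus f g : smooth1 a b f -> smooth1 a b g ->
  smooth1 a b (fun t => f t + g t).
Proof. by move=> sf sg k; apply: Ck_plus (sf k) (sg k). Qed.

Lemma smooth1_mult f g : smooth1 a b f -> smooth1 a b g ->
  smooth1 a b (fun t => f t * g t).
Proof. by move=> sf sg k; apply: Ck_mult (sf k) (sg k). Qed.

Lemma smooth1_opp f : smooth1 a b f -> smooth1 a b (fun t => - f t).
Proof.
move=> sf; have -> : (fun t => - f t) = (fun t => -1 * f t).
  by apply: functional_extensionality => t; ring.
exact: smooth1_mult (smooth1_const _) sf.
Qed.

Lemma smooth1_minus f g : smooth1 a b f -> smooth1 a b g ->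
  smooth1 a b (fun t => f t - g t).
Proof. by move=> sf sg; apply: smooth1_plus sf (smooth1_opp sg). Qed.

Lemma smooth1_sum (J : finType) (f : J -> R -> R) :
  (forall j, smooth1 a b (f j)) -> smooth1 a b (fun t => sumR (fun j => f j t)).
Proof.
by move=> sf k; apply: (Ck_sum (F := fun j (x : unit -> R) => f j (x tt))) => j; apply: sf.
Qed.

Lemma smooth1_sub a' b' f : a <= a' -> b' <= b -> smooth1 a b f -> smooth1 a' b' f.
Proof. by move=> aa bb sf k; apply: Ck_sub (sf k) => x; lra. Qed.

End Smooth1.

Section Multipliers.
Variables (I K : finType) (a b t0 t1 : R).
Variables (A : I -> I -> R -> R) (B : I -> K -> R -> R).
Variables (l : I -> R -> R) (m : K -> R -> R).
Hypothesis at0 : a < t0.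
Hypothesis t01 : t0 < t1.
Hypothesis t1b : t1 < b.
Hypothesis sA : forall i j, smooth1 a b (A i j).
Hypothesis sB : forall i c, smooth1 a b (B i c).
Hypothesis sl : forall i, smooth1 a b (l i).
Hypothesis sm : forall c, smooth1 a b (m c).

Definition controlled a' b' (x : I -> R -> R) (g : K -> R -> R) :=
  forall i t, a' < t < b' -> derivable_pt_lim (x i) t
    (sumR (fun k => A i k t * x k t) + sumR (fun c => B i c t * g c t)).

(** The source h is a parameter: h = l gives the candidate multipliers, h = 0 the homogeneous
    solutions that are added to them. *)
Definition costate a' b' (h p : I -> R -> R) :=
  (forall i, smooth1 a' b' (p i)) /\
  (forall i t, a' < t < b' -> derivable_pt_lim (p i) t
    (sumR (fun k => - A k i t * p k t) + h i t)).

(** The integrand is the derivative of p.x, by [adjoint_pairing]. *)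
Lemma costate_boundary a' b' h p x g : a <= a' -> a' < t0 -> t1 < b' -> b' <= b ->
  (forall i, smooth1 a' b' (h i)) -> costate a' b' h p ->
  (forall i, smooth1 a' b' (x i)) -> (forall c, smooth1 a' b' (g c)) ->
  controlled a' b' x g ->
  RInt (fun t => sumR (fun i => h i t * x i t) +
                 sumR (fun c => sumR (fun i => p i t * B i c t) * g c t)) t0 t1 =
  sumR (fun i => p i t1 * x i t1) - sumR (fun i => p i t0 * x i t0).
Proof.
move=> aa a't0 t1b' bb sh [sp dp] sx sg dx.
apply: (@RInt_derivative t0 t1 t01 (fun t => sumR (fun i => p i t * x i t))).
  move=> t tab; rewrite -(adjoint_pairing (fun i j => A i j t) (fun i c => B i c t)).
  apply: (derivable_pt_lim_sumR (f := fun i t => p i t * x i t)) => i.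
  by apply: derivable_pt_lim_mult; [apply: dp; lra|apply: dx; lra].
move=> t tab; apply: (smooth1_continuity (a := a') (b := b')); last by lra.
apply: smooth1_plus; apply: smooth1_sum => i; apply: smooth1_mult => //.
apply: smooth1_sum => k; apply: smooth1_mult => //.
exact: smooth1_sub (sB k i).
Qed.

(** The interval (a', b') is left free because the field to which this is applied lives on a smaller
    neighbourhood of [t0, t1] than the coefficients. *)
Hypothesis stationary : forall a' b' x g, a' < t0 -> t1 < b' ->
  (forall i, smooth1 a' b' (x i)) -> (forall c, smooth1 a' b' (g c)) ->
  controlled a' b' x g -> (forall i, x i t0 = 0) -> (forall i, x i t1 = 0) ->
  RInt (fun t => sumR (fun i => l i t * x i t) + sumR (fun c => m c t * g c t)) t0 t1 = 0.

Lemma multiplier_exists : exists p : I -> R -> R, forall t, t0 <= t <= t1 ->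
  (forall i, derivable_pt_lim (p i) t (sumR (fun k => - A k i t * p k t) + l i t)) /\
  (forall c, sumR (fun i => p i t * B i c t) = m c t).
Proof.
(* Two successive shrinkings: costates live on (a1, b1), and the field steered by a control built
   from them on (a2, b2). *)
set a1 := (a + t0) / 2; set b1 := (t1 + b) / 2.
set a2 := (a1 + t0) / 2; set b2 := (t1 + b1) / 2.
have [aa1 a12 a2t0] : [/\ a < a1, a1 < a2 & a2 < t0] by rewrite /a2 /a1; split; lra.
have [t1b2 b21 b1b] : [/\ t1 < b2, b2 < b1 & b1 < b] by rewrite /b2 /b1; split; lra.
have adj h q : (forall i, smooth1 a b (h i)) ->
    exists p, costate a1 b1 h p /\ forall i, p i t1 = q i.
  move=> sh; have [||p [pq dp sp]] := @linear_ode I (fun i k t => - A k i t) h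
    a b a1 b1 t1 q aa1 b1b ltac:(lra) => // [i k|]; first exact: smooth1_opp.
  by exists p.
pose z0 (i : I) (t : R) := 0.
have sz0 i : smooth1 a b (z0 i) by apply: smooth1_const.
have [p0 [cp0 _]] := adj l (fun=> 0) sl.
have exP j := adj z0 (fun i => if i == j then 1 else 0) sz0.
pose P j := sval (constructive_indefinite_description _ (exP j)).
have cP j : costate a1 b1 z0 (P j).
  by case: (svalP (constructive_indefinite_description _ (exP j))).
have Pt1 j i : P j i t1 = if i == j then 1 else 0.
  have [_ Pj] := svalP (constructive_indefinite_description _ (exP j)); exact: Pj.
(* Controls are encoded as functions of (t, c) to fit the abstract orthogonalization. The form is
   the L2 product over [t0, t1]; it ignores values outside and is thus only semidefinite on [S]. *)
pose S (u : R * K -> R) := forall c, smooth1 a1 b1 (fun t => u (t, c)).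
pose form (u w : R * K -> R) := RInt (fun t => sumR (fun c => u (t, c) * w (t, c))) t0 t1.
pose Bt (p : I -> R -> R) (tc : R * K) := sumR (fun i => p i tc.1 * B i tc.2 tc.1).
pose res p tc := m tc.2 tc.1 - Bt p tc.
have sub1 f : smooth1 a b f -> smooth1 a1 b1 f by apply: smooth1_sub; lra.
have SBt h p : costate a1 b1 h p -> S (Bt p).
  move=> [sp _] c; apply: smooth1_sum => i; apply: smooth1_mult => //.
  exact: sub1 (sB i c).
have S_comb u k w : S u -> S w -> S (fun tc => u tc + k * w tc).
  move=> Su Sw c; apply: smooth1_plus (Su c) _.
  exact: smooth1_mult (smooth1_const _ _ k) (Sw c).
have form_cont u w t : S u -> S w -> t0 <= t <= t1 ->
    continuity_pt (fun t => sumR (fun c => u (t, c) * w (t, c))) t.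
  move=> Su Sw tab; apply: (smooth1_continuity (a := a1) (b := b1)); last lra.
  by apply: smooth1_sum => c; apply: smooth1_mult (Su c) (Sw c).
have form_comb u k w x : S u -> S w -> S x ->
    form (fun tc => u tc + k * w tc) x = form u x + k * form w x.
  move=> Su Sw Sx; rewrite /form -(RInt_lin t01); last 2 first.
  - by move=> t; apply: form_cont.
  - by move=> t; apply: form_cont.
  apply: RInt_ext => t _; rewrite -sumR_scal -sumR_plus.
  by apply: sumR_ext => c; ring.
have form_sym u w : form u w = form w u.
  by apply: RInt_ext => t _; apply: sumR_ext => c; ring.
have form_ge0 u : S u -> 0 <= form u u.
  move=> Su; apply: RInt_ge_0; first lra.
    by apply: (ex_RInt_cont t01) => t; apply: form_cont.
  by move=> t _; apply: sumR_ge0 => c; apply: Rle_0_sqr.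
have Sres0 : S (res p0).
  move=> c; apply: smooth1_minus; first exact: sub1 (sm c).
  exact: (SBt l p0 cp0 c).
have [u [uP u0]] := orthogonal_complement S_comb form_comb form_sym form_ge0
  (enum I) (fun j => SBt z0 (P j) (cP j)) Sres0.
have Su : S u by apply: uP => // x k j _ Sx; apply: S_comb => //; apply: SBt (cP j).
(* Adding k B^T P_j to a residual amounts to subtracting k P_j from the costate, which preserves the
   equation with source l because P_j is homogeneous. *)
have [p [cp pu]] : exists p, costate a1 b1 l p /\ forall tc, u tc = res p tc.
  apply: (uP (fun u => exists p, costate a1 b1 l p /\ forall tc, u tc = res p tc))
    => [|x k j _ [p [[sp dp] px]]]; first by exists p0.
  have [sPj dPj] := cP j.
  exists (fun i t => p i t - k * P j i t); split; last first.
    move=> tc; rewrite px /res /Bt.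
    have -> : sumR (fun i => (p i tc.1 - k * P j i tc.1) * B i tc.2 tc.1) =
      sumR (fun i => p i tc.1 * B i tc.2 tc.1) +
      - k * sumR (fun i => P j i tc.1 * B i tc.2 tc.1).
      by rewrite -sumR_scal -sumR_plus; apply: sumR_ext => i; ring.
    by ring.
  split=> i.
    apply: smooth1_minus => //; exact: smooth1_mult (smooth1_const _ _ k) (sPj i).
  move=> t tab.
  have -> : sumR (fun h => - A h i t * (p h t - k * P j h t)) + l i t =
    (sumR (fun h => - A h i t * p h t) + l i t) -
    k * (sumR (fun h => - A h i t * P j h t) + z0 i t).
    have -> : sumR (fun h => - A h i t * (p h t - k * P j h t)) =
      sumR (fun h => - A h i t * p h t) + - k * sumR (fun h => - A h i t * P j h t).
      by rewrite -sumR_scal -sumR_plus; apply: sumR_ext => h; ring.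
    by rewrite /z0; ring.
  apply: derivable_pt_lim_minus (dp i t tab) _.
  exact: derivable_pt_lim_scal (dPj i t tab).
pose g (c : K) (t : R) := u (t, c).
have sg c : smooth1 a1 b1 (g c) by apply: Su.
have sub2 f : smooth1 a1 b1 f -> smooth1 a2 b2 f by apply: smooth1_sub; lra.
have [||x [xt0 dx sx]] := @linear_ode I A (fun i t => sumR (fun c => B i c t * g c t))
    a1 b1 a2 b2 t0 (fun=> 0) a12 b21 ltac:(lra).
- by move=> i j; apply: sub1 (sA i j).
- by move=> i; apply: smooth1_sum => c; apply: smooth1_mult (sub1 _ (sB i c)) (sg c).
have sg2 c := sub2 _ (sg c).
have boundary h q : costate a1 b1 h q -> (forall i, smooth1 a b (h i)) ->
    RInt (fun t => sumR (fun i => h i t * x i t) +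
                 sumR (fun c => sumR (fun i => q i t * B i c t) * g c t)) t0 t1 =
    sumR (fun i => q i t1 * x i t1).
  move=> [sq dq] sh.
  have -> := @costate_boundary a2 b2 h q x g; try lra; try done.
  - rewrite [X in _ - X]sumR0 ?Rminus_0_r // => i; by rewrite xt0; ring.
  - by move=> i; apply: sub2; apply: sub1.
  - by split=> [i|i t tab]; [apply: sub2|apply: dq; lra].
(* Since P_j(t1) is the j-th basis vector and x(t0) = 0, the boundary identity expresses x_j(t1) as
   the L2 product of B^T P_j with the residual, which is zero. *)
have xt1 j : x j t1 = 0.
  have := u0 j; rewrite mem_enum form_sym => /(_ isT) <-.
  have -> : x j t1 = sumR (fun i => P j i t1 * x i t1).
    by rewrite -[LHS](sumR_delta (fun i => x i t1)); apply: sumR_ext => i; rewrite Pt1.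
  rewrite -(boundary z0 (P j) (cP j) sz0); apply: RInt_ext => t _.
  by rewrite [X in X + _]sumR0 ?Rplus_0_l // => i; rewrite /z0; ring.
have uu : form u u = 0.
  have := stationary a2t0 t1b2 sx sg2 dx xt0 xt1.
  have := boundary l p cp sl.
  rewrite [RHS]sumR0 => [|i]; last by rewrite xt1; ring.
  set f1 := fun t => _; set f2 := fun t => _ => I1 I2.
  have cf1 t : t0 <= t <= t1 -> continuity_pt f1 t.
    move=> tab; apply: (smooth1_continuity (a := a2) (b := b2)); last lra.
    apply: smooth1_plus; apply: smooth1_sum => i; apply: smooth1_mult => //.
      by apply: sub2; apply: sub1.
    by apply: sub2; apply: (SBt l p cp i).
  have cf2 t : t0 <= t <= t1 -> continuity_pt f2 t.
    move=> tab; apply: (smooth1_continuity (a := a2) (b := b2)); last lra.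
    by apply: smooth1_plus; apply: smooth1_sum => i; apply: smooth1_mult => //;
      apply: sub2; apply: sub1.
  (* Both integrals vanish, that of [f2] by stationarity and that of [f1] by the boundary identity;
     the terms in l cancel and (m - B^T p).g = |g|^2 remains. *)
  have -> : form u u = RInt (fun t => f2 t + -1 * f1 t) t0 t1.
    apply: RInt_ext => t _; rewrite /f1 /f2.
    have -> : sumR (fun c => u (t, c) * u (t, c)) =
      sumR (fun c => m c t * g c t) + -1 * sumR (fun c => sumR (fun i => p i t * B i c t) * g c t).
      by rewrite -sumR_scal -sumR_plus; apply: sumR_ext => c; rewrite /g {1}pu /res /Bt /=; ring.
    by apply: Rminus_diag_uniq; ring.
  by rewrite (RInt_lin t01) // I1 I2 Rmult_0_r Rplus_0_r.
have ug0 := RInt_nonneg_eq0 t01 (fun t => form_cont u u t Su Su)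
  (fun t _ => sumR_ge0 (fun c => Rle_0_sqr (u (t, c)))) uu.
exists p => t tab; split=> [i|c]; first by have [_ dp] := cp; apply: dp; lra.
have := ug0 t tab; have := le_sumR (f := fun c => u (t, c) * u (t, c)) c
  (fun c => Rle_0_sqr (u (t, c))).
move=> /= le eq0; rewrite eq0 in le.
have /Rsqr_0_uniq : Rsqr (u (t, c)) = 0 by apply: Rle_antisym => //; apply: Rle_0_sqr.
by rewrite pu /res /Bt /=; lra.
Qed.

End Multipliers.

(** * First variation *)

Lemma open_preimage (I J : finType) (D : (I -> R) -> Prop) (U : (J -> R) -> Prop)
    (c : J -> (I -> R) -> R) : open_set D -> open_set U -> (forall j, cont_on D (c j)) ->
  open_set (fun x => D x /\ U (fun j => c j x)).
Proof.
move=> oD oU cc x [Dx Ux].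
have [d1 [d10 dD]] := oD x Dx; have [d2 [d20 dU]] := oU _ Ux.
have [d3 [d30 dc]] : exists d, 0 < d /\ forall j y, D y ->
    (forall i, Rabs (y i - x i) < d) -> Rabs (c j y - c j x) < d2.
  apply: (common_radius (P := fun j d => forall y, D y ->
    (forall i, Rabs (y i - x i) < d) -> Rabs (c j y - c j x) < d2)).
    move=> j d d' P [_ le] y Dy yx; apply: P => // i; exact: Rlt_le_trans (yx i) le.
  by move=> j; apply: cc.
exists (Rmin d1 d3); split; first exact: Rmin_glb_lt.
move=> y yx; have Dy : D y by apply: dD => i; apply: Rlt_le_trans (yx i) (Rmin_l _ _).
split=> //; apply: dU => j; apply: dc => // i.
exact: Rlt_le_trans (yx i) (Rmin_r _ _).
Qed.

Lemma open_rectangle e a b :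
  open_set (fun x : bool -> R => - e < x true < e /\ a < x false < b).
Proof.
move=> x [xe xab].
exists (Rmin (Rmin (e - x true) (x true + e)) (Rmin (x false - a) (b - x false))).
split; first by do !apply: Rmin_glb_lt; lra.
move=> y yx.
have t1 := Rlt_le_trans _ _ _ (yx true) (Rmin_l _ _).
have t2 := Rlt_le_trans _ _ _ t1 (Rmin_l _ _); have t3 := Rlt_le_trans _ _ _ t1 (Rmin_r _ _).
have f1 := Rlt_le_trans _ _ _ (yx false) (Rmin_r _ _).
have f2 := Rlt_le_trans _ _ _ f1 (Rmin_l _ _); have f3 := Rlt_le_trans _ _ _ f1 (Rmin_r _ _).
by move: t2 t3 f2 f3; split_Rabs; lra.
Qed.

Definition point2 (xi t : R) : bool -> R := fun c => if c then xi else t.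

(** The action is differentiated under the integral sign, the integrand being smooth jointly in (xi,
    t). The chain rule identifies the derivative at 0 with the stated integral, and extremality with
    0. *)
Lemma first_variation n r (U : (coord n r -> R) -> Prop) psi (L : (coord n r -> R) -> R)
    t0 t1 q z eps Q Z (X : R -> 'I_n -> R) (G : R -> 'I_r -> R) :
  open_set U -> smooth_on U L -> t0 < t1 -> extremal U psi L t0 t1 q z ->
  adm_deformation U psi t0 t1 q z eps Q Z ->
  (forall t, t0 <= t <= t1 ->
     (forall i, derivable_pt_lim (fun xi => Q xi t i) 0 (X t i)) /\
     (forall a, derivable_pt_lim (fun xi => Z xi t a) 0 (G t a))) ->
  RInt (fun t => sumR (fun i => pd L (dq r i) (pt t (q t) (z t)) * X t i) +
                 sumR (fun a => pd L (dz n a) (pt t (q t) (z t)) * G t a)) t0 t1 = 0.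
Proof.
move=> oU sL t01 ext def tan; have [J [JQ dJ]] := ext _ _ _ def.
have [e0 [[a [b [at0 [t1b [sQ sZ]]]]] [admQ [Q0 _]]]] := def.
set D := (fun x : bool -> R => _) in sQ sZ.
pose c (j : coord n r) (x : bool -> R) :=
  pt (x false) (Q (x true) (x false)) (Z (x true) (x false)) j.
have sc j : smooth_on D (c j).
  move=> k; case: j => [u|[i|d]]; [exact: Ck_coord|exact: sQ|exact: sZ].
(* The composite with [L] is smooth only where the deformed curve stays in [U]; this open set
   contains all (xi, t) with |xi| < eps and t in [t0, t1]. *)
pose V (x : bool -> R) := D x /\ U (fun j => c j x).
have oV : open_set V.
  by apply: open_preimage => // [|j]; [exact: open_rectangle|exact: sc j O].
pose g x := L (fun j => c j x).
have sg : smooth_on V g.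
  move=> k; apply: (Ck_comp oU) => [x []//| |j]; first exact: sL.
  by apply: Ck_sub (sc j k) => x [].
pose h xi t := g (point2 xi t).
have dh xi t : V (point2 xi t) ->
    derivable_pt_lim (fun xi => h xi t) xi (pd g true (point2 xi t)).
  move=> Vx; have := smooth_partial true sg Vx; rewrite /is_partial.
  have -> // : (fun xi' => g (upd (point2 xi t) true xi')) = (fun xi' => h xi' t).
  apply: functional_extensionality => xi'; congr g.
  by apply: functional_extensionality => -[].
have inV xi t : - eps < xi < eps -> t0 <= t <= t1 -> V (point2 xi t).
  move=> xie tab; split; first by split=> //=; lra.
  by have [] := admQ xi xie t tab.
have Dh xi t : V (point2 xi t) -> Derive (fun xi => h xi t) xi = pd g true (point2 xi t).
  by move=> /dh /is_derive_Reals /is_derive_unique.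
have d1 : is_derive (fun xi => RInt (fun t => h xi t) t0 t1) 0
    (RInt (fun t => Derive (fun xi => h xi t) 0) t0 t1).
  apply: is_derive_RInt_param; rewrite ?Rmin_left ?Rmax_right; try lra.
  - exists (mkposreal _ e0) => xi; rewrite /ball /= /AbsRing_ball /abs /minus /plus /opp /=.
    move=> xie t tab; exists (pd g true (point2 xi t)); apply/is_derive_Reals/dh/inV => //.
    by move: xie; split_Rabs; lra.
  - move=> t tab e.
    have V0 : V (point2 0 t) by apply: inV => //; lra.
    have [d2 [d20 dV]] := oV _ V0.
    have [d3 [d30 dg]] := Ck_cont (smooth_pd true oV sg O) V0 (cond_pos e).
    have d0 : 0 < Rmin d2 d3 by apply: Rmin_glb_lt.
    exists (mkposreal _ d0) => u v /= u0 vt.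
    have Vuv : V (point2 u v).
      by apply: dV => -[] /=; [apply: Rlt_le_trans u0 (Rmin_l _ _)|
                               apply: Rlt_le_trans vt (Rmin_l _ _)].
    rewrite !Dh //; apply: dg => // -[] /=.
      exact: Rlt_le_trans u0 (Rmin_r _ _).
    exact: Rlt_le_trans vt (Rmin_r _ _).
  - exists (mkposreal _ e0) => xi; rewrite /ball /= /AbsRing_ball /abs /minus /plus /opp /=.
    move=> xie; have [|pr _] := JQ xi; first by move: xie; split_Rabs; lra.
    exact: ex_RInt_Reals_1 pr.
have d2 : is_derive (fun xi => RInt (fun t => h xi t) t0 t1) 0 0.
  move/is_derive_Reals: dJ; apply: is_derive_ext_loc.
  exists (mkposreal _ e0) => xi; rewrite /ball /= /AbsRing_ball /abs /minus /plus /opp /=.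
  move=> xie; have [|pr <-] := JQ xi; first by move: xie; split_Rabs; lra.
  exact: esym (RInt_Reals _ _ _ pr).
have := is_derive_unique _ _ _ d1; rewrite (is_derive_unique _ _ _ d2) => ->.
apply: RInt_ext => t; rewrite Rmin_left ?Rmax_right; try lra; move=> tab.
have tab' : t0 <= t <= t1 by lra.
have [Qq Zz] := Q0 t tab'; have [dQ dZ] := tan t tab'.
have U0 : U (fun j => c j (point2 0 t)) by have [] := inV 0 t ltac:(lra) tab'.
(* The deformation does not move t, so the time component of its velocity is 0. *)
have := chain_rule oU (fun i x => @smooth_partial _ U L i x sL) (fun i => smooth_pd i oU sL O)
  (c := fun j xi => c j (point2 xi t)) (c' := pt 0 (X t) (G t)) U0 _.
have dc j : derivable_pt_lim (fun xi => c j (point2 xi t)) 0 (pt 0 (X t) (G t) j).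
  case: j => [u|[i|d]]; [exact: derivable_pt_lim_const|exact: dQ|exact: dZ].
move=> /(_ dc) /is_derive_Reals /is_derive_unique ->.
rewrite sumR_coord /= Rmult_0_r Rplus_0_l /c /= Qq Zz.
by [].
Qed.

(* The zero infinitesimal deformation is tangent to some smooth deformation of an
   ordinary evolution; its member at xi = 0 extends the lift smoothly beyond
   [t0, t1]. *)
Lemma ordinary_smooth_extension n r (U : (coord n r -> R) -> Prop) psi t0 t1 q z :
  open_set U -> t0 < t1 -> admissible_lift U psi t0 t1 q z -> ordinary U psi t0 t1 q z ->
  exists (c : R -> coord n r -> R) a b, [/\ a < t0, t1 < b,
    forall t, t0 <= t <= t1 -> c t = pt t (q t) (z t) &
    forall F, smooth_on U F -> smooth1 a b (fun t => F (c t))].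
Proof.
move=> oU t01 adm ord.
have zero_deformation : adm_inf_deformation psi t0 t1 q z (fun _ _ => 0) (fun _ _ => 0).
  split.
    by exists (t0 - 1), (t1 + 1); do !(split; first lra); split=> _; apply: smooth1_const.
  move=> t _ i; rewrite !sumR0 ?Rplus_0_r; first exact: derivable_pt_lim_const.
    by move=> k; rewrite Rmult_0_r.
  by move=> k; rewrite Rmult_0_r.
have [eps [Q [Z [[e0 [[a [b [at0 [t1b [sQ sZ]]]]] [_ [Q0 _]]]] _]]]] :=
  ord _ _ zero_deformation (fun=> erefl) (fun=> erefl).
pose c t := pt t (Q 0 t) (Z 0 t).
have cE t : t0 <= t <= t1 -> c t = pt t (q t) (z t).
  by move=> tab; rewrite /c; have [-> ->] := Q0 t tab.
(* Freezing xi = 0 is composition with the smooth map sending t to (0, t). *)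
have sub (f : R -> R -> R) : smooth_on
    (fun x : bool -> R => - eps < x true < eps /\ a < x false < b)
    (fun x => f (x true) (x false)) -> smooth1 a b (f 0).
  move=> sf k.
  apply: (Ck_comp (@open_rectangle eps a b) (F := fun x => f (x true) (x false))
    (c := fun j y => point2 0 (y tt) j)) => // [x xab|[]].
  - by split=> //=; lra.
  - exact: Ck_const.
  - exact: Ck_coord.
have sc j : smooth1 a b (fun t => c t j).
  case: j => [u|[i|d]].
  - by move=> k; apply: Ck_coord.
  - by apply: (sub (fun xi t => Q xi t i)); apply: sQ.
  - by apply: (sub (fun xi t => Z xi t d)); apply: sZ.
pose V (x : unit -> R) := interval a b x /\ U (fun j => c (x tt) j).
have oV : open_set V.
  apply: (open_preimage (c := fun j x => c (x tt) j)) => //; first exact: open_interval.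
  by move=> j; apply: (sc j O).
have inV t : t0 <= t <= t1 -> V (fun=> t).
  move=> tab; split; first lra.
  by rewrite -/(c t) cE //; case: (adm t tab).
(* Membership in [U] is known only over [t0, t1]; openness at the two end-points supplies the margin
   on either side. *)
have [d0 [d00 dV0]] := oV _ (inV t0 ltac:(lra)).
have [d1 [d10 dV1]] := oV _ (inV t1 ltac:(lra)).
have inV' x : interval (t0 - d0) (t1 + d1) x -> V x.
  move=> xab; have [x0|x0] := Rlt_le_dec (x tt) t0.
    by apply: dV0 => -[]; split_Rabs; lra.
  have [x1|x1] := Rlt_le_dec t1 (x tt).
    by apply: dV1 => -[]; split_Rabs; lra.
  exact: inV (x tt) (conj x0 x1).
exists c, (t0 - d0), (t1 + d1); split=> //; try lra.
move=> F sF k; apply: (Ck_comp oU (c := fun j x => c (x tt) j)) => [x /inV' [] //| |j].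
  exact: sF.
by apply: Ck_sub (sc j k) => x /inV' [].
Qed.

Theorem theorem2p1 (n r : nat) (U : (coord n r -> R) -> Prop)
  (psi : 'I_n -> (coord n r -> R) -> R) (L : (coord n r -> R) -> R)
  (t0 t1 : R) (q : R -> 'I_n -> R) (z : R -> 'I_r -> R) :
  setup U psi L ->
  t0 < t1 ->
  admissible_lift U psi t0 t1 q z ->
  ordinary U psi t0 t1 q z ->
  extremal U psi L t0 t1 q z ->
  exists p : R -> 'I_n -> R,
    forall t, t0 <= t <= t1 ->
      (forall i, exists dp, derivable_pt_lim (fun s => p s i) t dp /\
         dp + sumR (fun k => p t k * pd (psi k) (dq r i) (pt t (q t) (z t)))
           = pd L (dq r i) (pt t (q t) (z t))) /\
      (forall a, sumR (fun k => p t k * pd (psi k) (dz n a) (pt t (q t) (z t)))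
           = pd L (dz n a) (pt t (q t) (z t))).
Proof.
move=> [oU [spsi [sL _]]] t01 adm ord ext.
have [c [a [b [at0 t1b cE sc]]]] := ordinary_smooth_extension oU t01 adm ord.
have spd F j : smooth_on U F -> smooth1 a b (fun t => pd F j (c t)).
  by move=> sF; apply: sc; apply: smooth_pd.
(* The coefficients are read along the smooth extension [c] of the lift, with which it agrees on
   [t0, t1]. *)
pose A i k t := pd (psi i) (dq r k) (c t).
pose B i d t := pd (psi i) (dz n d) (c t).
pose l i t := pd L (dq r i) (c t).
pose m d t := pd L (dz n d) (c t).
have [|p pP] := @multiplier_exists _ _ a b t0 t1 A B l m at0 t01 t1b
  (fun i k => spd _ _ (spsi i)) (fun i d => spd _ _ (spsi i))
  (fun i => spd _ _ sL) (fun d => spd _ _ sL).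
  (* A controlled field vanishing at both ends is an admissible infinitesimal deformation;
     ordinarity integrates it to a deformation, along which the first variation vanishes. *)
  move=> a' b' x g a't0 t1b' sx sg dx x0 x1.
  have [|eps [Q [Z [def tan]]]] := ord (fun t i => x i t) (fun t d => g d t) _ x0 x1.
    split; first by exists a', b'; do !split=> //.
    by move=> t tab i; rewrite -cE //; apply: dx; lra.
  rewrite -(first_variation oU sL t01 ext def tan).
  apply: RInt_ext => t; rewrite Rmin_left ?Rmax_right; try lra; move=> tab.
  by rewrite -cE //; lra.
exists (fun t i => p i t) => t tab; have [dp mp] := pP t tab.
rewrite -cE //; split=> [i|d]; last exact: mp.
eexists; split; first exact: dp.
have -> : sumR (fun k => - A k i t * p k t) =
    -1 * sumR (fun k => p k t * pd (psi k) (dq r i) (c t)).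
  by rewrite -sumR_scal; apply: sumR_ext => k; rewrite /A; ring.
by rewrite /l; ring.
Qed.
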